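(* Let $n\ge 1$ and $w\in S_n$. The Schubert polynomial $\mathfrak{S}_w$ is zero-one if and only if $w$ avoids each of the patterns $12543$, $13254$, $13524$, $13542$, $21543$, $125364$, $125634$, $215364$, $215634$, $315264$, $315624$, and $315642$.
   Context: For $w\in S_n$, the Schubert polynomial $\mathfrak{S}_w\in\mathbb{Z}[x_1,\dots,x_n]$ is defined by $\mathfrak{S}_{w_0}=x_1^{n-1}x_2^{n-2}\cdots x_{n-1}$ for $w_0=n\,(n-1)\cdots 1$, and $\mathfrak{S}_w=\partial_i\mathfrak{S}_{ws_i}$ whenever $w_i<w_{i+1}$, where $s_i$ is the transposition of $i,i+1$ and $\partial_i f=\frac{f-s_if}{x_i-x_{i+1}}$ ($s_i$ swapping $x_i,x_{i+1}$). A polynomial is zero-one if every coefficient is $0$ or $1$. A pattern of length $m$ is a permutation $\sigma\in S_m$; $w\in S_n$ contains $\sigma$ if there are indices $j_1<\dots<j_m$ with $w_{j_1},\dots,w_{j_m}$ in the same relative order as $\sigma_1,\dots,\sigma_m$, and avoids $\sigma$ otherwise. Patterns of different lengths are not identified (e.g. $154623$ contains $132$ but not $132456$). *)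

(* Defs.v *)
From HB Require Import structures.
From mathcomp Require Import all_boot all_order all_algebra all_fingroup.
From mathcomp Require Import mpoly.
From Stdlib Require Import ClassicalEpsilon.
Set Implicit Arguments. Unset Strict Implicit. Unset Printing Implicit Defensive.
Import GRing.Theory.
Local Open Scope ring_scope.

Section Schubert.
Variable n : nat.

(* 0-based indices: the variable x_{i+1} of the paper is 'X_i, i : 'I_n. *)
Definition nxt (i : 'I_n) : 'I_n := insubd i i.+1.

Definition stp (i : 'I_n) : 'S_n := tperm i (nxt i).

(* divided difference: the (unique, when it exists) g with
   (x_i - x_{i+1}) * g = f - s_i f *)
Definition ddiff (i : 'I_n) (f : {mpoly int[n]}) : {mpoly int[n]} :=
  epsilon (inhabits 0)
    (fun g => f - msym (stp i) f = ('X_i - 'X_(nxt i)) * g).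

Definition w0 : 'S_n := perm (@rev_ord_inj n).

Definition schub_top : {mpoly int[n]} := \prod_(i < n) 'X_i ^+ (n - 1 - i)%N.

Definition ascent (w : 'S_n) (i : 'I_n) : bool := (i.+1 < n)%N && (w i < w (nxt i))%N.

(* the composite w s_i as functions, j |-> w (s_i j); in mathcomp (s * t) x = t (s x) *)
Definition wsi (w : 'S_n) (i : 'I_n) : 'S_n := (stp i * w)%g.

(* Recursive computation following the defining recursion, always using the
   first ascent; fuel n*n exceeds the maximal length n(n-1)/2. *)
Fixpoint schub_aux (k : nat) (w : 'S_n) : {mpoly int[n]} :=
  match k with
  | 0 => schub_top
  | k.+1 =>
      if w == w0 then schub_top else
      match [pick i | ascent w i] with
      | Some i => ddiff i (schub_aux k (wsi w i))
      | None => schub_top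
      end
  end.

Definition schubert (w : 'S_n) : {mpoly int[n]} := schub_aux (n * n) w.

Definition zero_one (p : {mpoly int[n]}) : Prop :=
  forall m : 'X_{1..n}, p@_m = 0 \/ p@_m = 1.

(* pattern containment; a pattern sigma in S_m is given by its one-line
   notation as a list of naturals *)
Definition contains (w : 'S_n) (sigma : seq nat) : Prop :=
  exists f : 'I_(size sigma) -> 'I_n,
    (forall a b : 'I_(size sigma), (a < b)%N -> (f a < f b)%N) /\
    (forall a b : 'I_(size sigma), (w (f a) < w (f b))%N = (nth 0%N sigma a < nth 0%N sigma b)%N).

Definition avoids (w : 'S_n) (sigma : seq nat) : Prop := ~ contains w sigma.

End Schubert.

Definition zero_one_patterns : seq (seq nat) :=
  [:: [:: 1; 2; 5; 4; 3]; [:: 1; 3; 2; 5; 4]; [:: 1; 3; 5; 2; 4];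
      [:: 1; 3; 5; 4; 2]; [:: 2; 1; 5; 4; 3];
      [:: 1; 2; 5; 3; 6; 4]; [:: 1; 2; 5; 6; 3; 4]; [:: 2; 1; 5; 3; 6; 4];
      [:: 2; 1; 5; 6; 3; 4]; [:: 3; 1; 5; 2; 6; 4]; [:: 3; 1; 5; 6; 2; 4];
      [:: 3; 1; 5; 6; 4; 2]]%N.

(* Main.v *)
Require Import Defs.
From HB Require Import structures.
From mathcomp Require Import all_boot all_order all_algebra all_fingroup.
From mathcomp Require Import mpoly.
From mathcomp Require Import zify ring.
From Stdlib Require Import FunctionalExtensionality ClassicalEpsilon.
Set Implicit Arguments. Unset Strict Implicit. Unset Printing Implicit Defensive.

(** The coefficients of a Schubert polynomial count pipe dreams (Fomin and Stanley: the divided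
    differences are computed in the nilCoxeter algebra, with the Yang-Baxter equation), so the
    polynomial is zero-one iff distinct pipe dreams of [w] have distinct weights. Peeling off the
    first row turns the word [e t] into shorter words: [e] is removed, and letters above [e] may
    slide down past adjacent values standing to their right, each step costing a factor x_1.

    Both directions are inductions on this recursion, according to the first letter [b] of [t] above
    [e]; call the letters above [e] small if they are less than [b] and large if they exceed [b].
    If there is no small letter, [e] and [b] can be exchanged at the cost of a factor x_1. Otherwise
    the large letters of an avoiding word increase, by 13254, 13524 and 13542. If moreover [b]
    follows [e] immediately, then [b] can be removed: the pipe dreams of [e b ...] arise from those of
    the word without [b] by splitting the first row in two, and the weight records where. If not,
    the small letters increase by 21543, so a first row only slides [b] and is determined by its
    length, and the shorter words still avoid the patterns. Conversely, if a pattern occurs, either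
    some slide of [b] leads to a shorter word with a pattern, or two first rows of length one lead
    to a common monomial, because a crossing of the bottom pipe dream can be moved up to any row
    whose letter lies to the north-west of it. *)

(** * Words and pipe dreams *)

Definition tau j v := if v == j then j.+1 else if v == j.+1 then j else v.

Lemma tauK j : involutive (tau j).
Proof. by move=> v; rewrite /tau; do !case: eqP; lia. Qed.

Lemma tau_inj j : injective (tau j). Proof. exact: inv_inj (tauK j). Qed.

Lemma tau_far j v : v != j -> v != j.+1 -> tau j v = v.
Proof. by rewrite /tau => /negbTE-> /negbTE->. Qed.

Lemma tauL j : tau j j = j.+1. Proof. by rewrite /tau eqxx. Qed.

Lemma tauR j : tau j j.+1 = j. Proof. by rewrite /tau eqxx; case: eqP => //; lia. Qed.

Lemma tau_comm j k v : j.+1 < k -> tau j (tau k v) = tau k (tau j v).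
Proof. by move=> ?; rewrite /tau; do !case: eqP; lia. Qed.

Lemma tau_braid j v :
  tau j (tau j.+1 (tau j v)) = tau j.+1 (tau j (tau j.+1 v)).
Proof. by rewrite /tau; do !case: eqP; lia. Qed.

Definition swapv j (t : seq nat) := map (tau j) t.

(** A missing letter has index [size t], so it counts as standing at the end. *)
Definition invv j (t : seq nat) := index j.+1 t < index j t.

Lemma size_swapv j t : size (swapv j t) = size t. Proof. exact: size_map. Qed.

Lemma index_swapv j v t : index v (swapv j t) = index (tau j v) t.
Proof. by rewrite -{1}(tauK j v) /swapv index_map //; apply: tau_inj. Qed.

Lemma swapvK j t : swapv j (swapv j t) = t.
Proof. by rewrite /swapv -map_comp -[RHS]map_id; apply: eq_map => v /=; rewrite tauK. Qed.

Lemma swapv_comm j k t : j.+1 < k -> swapv j (swapv k t) = swapv k (swapv j t).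
Proof. by move=> h; rewrite /swapv -!map_comp; apply: eq_map => v /=; rewrite tau_comm. Qed.

Lemma swapv_braid j t : swapv j (swapv j.+1 (swapv j t)) = swapv j.+1 (swapv j (swapv j.+1 t)).
Proof. by rewrite /swapv -!map_comp; apply: eq_map => v /=; rewrite tau_braid. Qed.

(** Each swap has to remove an inversion, so the product of transpositions stays reduced. *)
Fixpoint run_row T t := if T is j :: T' then invv j t && run_row T' (swapv j t) else true.

Definition app_row T t := foldl (fun t j => swapv j t) t T.

Definition act_row T v := foldl (fun v j => tau j v) v T.

Definition is_row lo T t := [&& sorted gtn T, all (leq lo) T & run_row T t].

Lemma run_cat T1 T2 t : run_row (T1 ++ T2) t = run_row T1 t && run_row T2 (app_row T1 t).
Proof. by elim: T1 t => //= j T1 IH t; rewrite IH andbA. Qed.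

Lemma app_row_cat T1 T2 t : app_row (T1 ++ T2) t = app_row T2 (app_row T1 t).
Proof. exact: foldl_cat. Qed.

Lemma app_rowE T t : app_row T t = map (act_row T) t.
Proof.
elim: T t => [|j T IH] t; first by rewrite /app_row /act_row /= map_id.
by rewrite /app_row /= -/(app_row T _) IH /swapv -map_comp.
Qed.

Lemma act_row_inj T : injective (act_row T).
Proof. by elim: T => [|j T IH] //= v v' /IH /tau_inj. Qed.

Lemma index_app_row T v t : index (act_row T v) (app_row T t) = index v t.
Proof. by rewrite app_rowE index_map //; apply: act_row_inj. Qed.

Lemma mem_app_row T v t : (act_row T v \in app_row T t) = (v \in t).
Proof. by rewrite app_rowE mem_map //; apply: act_row_inj. Qed.

Lemma size_app_row T t : size (app_row T t) = size t.
Proof. by rewrite app_rowE size_map. Qed.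

Lemma mem_swapv j v t : (v \in swapv j t) = (tau j v \in t).
Proof. by rewrite -{1}(tauK j v) mem_map //; apply: tau_inj. Qed.

Lemma act_row_below lo T v : all (leq lo) T -> v < lo -> act_row T v = v.
Proof.
elim: T => //= j T IH /andP[h1 h2] h.
by rewrite /act_row /= -/(act_row T _) tau_far ?IH //; lia.
Qed.

(** * Removing and prefixing a letter, with restandardization *)

Definition unbumpv e v := if e < v then v.-1 else v.
Definition bumpv e v := if e <= v then v.+1 else v.
Definition unbumps e t := map (unbumpv e) t.
Definition cons_std e t := e :: map (bumpv e) t.

Lemma bumpvK e : cancel (bumpv e) (unbumpv e).
Proof. by move=> v; rewrite /bumpv /unbumpv; do !case: ifP; lia. Qed.

Lemma unbumpvK e v : v != e -> bumpv e (unbumpv e v) = v.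
Proof. by rewrite /bumpv /unbumpv; do !case: ifP; lia. Qed.

Lemma ltn_bumpv e v v' : (bumpv e v < bumpv e v') = (v < v').
Proof. by rewrite /bumpv; do !case: ifP; lia. Qed.

Lemma bumpv_inj e : injective (bumpv e). Proof. exact: can_inj (bumpvK e). Qed.

Lemma bumpv_neq e v : bumpv e v != e.
Proof. by rewrite /bumpv; do !case: ifP; lia. Qed.

Lemma ltn_bumpvR e v : (e < bumpv e v) = (e <= v).
Proof. by rewrite /bumpv; do !case: ifP; lia. Qed.

Lemma ltn_bumpvL e v : (bumpv e v < e) = (v < e).
Proof. by rewrite /bumpv; do !case: ifP; lia. Qed.

Lemma unbumps_bumpv e t : unbumps e (map (bumpv e) t) = t.
Proof. by rewrite /unbumps -map_comp -[RHS]map_id; apply: eq_map => v /=; rewrite bumpvK. Qed.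

Definition std_word (t : seq nat) := perm_eq t (iota 0 (size t)).

Lemma std_word_uniq t : std_word t -> uniq t.
Proof. by move/perm_uniq->; apply: iota_uniq. Qed.

Lemma std_word_mem t v : std_word t -> (v \in t) = (v < size t).
Proof. by move/perm_mem->; rewrite mem_iota. Qed.

Lemma std_wordI (t : seq nat) : uniq t -> (forall v, v \in t -> v < size t) -> std_word t.
Proof.
move=> u h; apply: uniq_perm; rewrite ?iota_uniq //.
have [] // := @uniq_min_size _ t (iota 0 (size t)) u; last by rewrite size_iota.
by move=> v /h; rewrite mem_iota.
Qed.

Lemma index_inj (t : seq nat) u v : u \in t -> index u t = index v t -> u = v.
Proof.
move=> hu e; rewrite -(nth_index 0 hu) e nth_index //.
by rewrite -index_mem -e index_mem.
Qed.

Lemma invv_mem j t : invv j t -> j.+1 \in t.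
Proof. by rewrite /invv => h; rewrite -index_mem; apply: leq_trans h (index_size _ _). Qed.

Lemma std_word_swapv j t : std_word t -> invv j t -> std_word (swapv j t).
Proof.
move=> w /invv_mem; rewrite std_word_mem // => hj.
apply: std_wordI; first by rewrite map_inj_uniq ?std_word_uniq //; apply: tau_inj.
move=> v; rewrite size_swapv mem_swapv std_word_mem // /tau.
by do !case: eqP; lia.
Qed.

Lemma std_word_app_row T t : std_word t -> run_row T t -> std_word (app_row T t).
Proof.
elim: T t => //= j T IH t w /andP[h1 h2].
by apply: IH h2; apply: std_word_swapv.
Qed.

Lemma std_word_cons_std e t : e <= size t -> std_word t -> std_word (cons_std e t).
Proof.
move=> he w; apply: std_wordI => /=.
  rewrite (map_inj_uniq (@bumpv_inj e)) (std_word_uniq w) andbT.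
  by apply/mapP => -[v _]; move: (bumpv_neq e v) => /eqP; congruence.
move=> v; rewrite inE size_map => /orP[/eqP->//|/mapP[v' ]].
by rewrite std_word_mem // /bumpv => ? ->; case: ifP; lia.
Qed.

Lemma std_word_cons e t : std_word (e :: t) ->
  [/\ e <= size t, std_word (unbumps e t) & e :: t = cons_std e (unbumps e t)].
Proof.
move=> w; have /= /andP[h1 h2] := std_word_uniq w.
have he : e <= size t by have := std_word_mem e w; rewrite inE eqxx /=; lia.
have E : map (bumpv e) (unbumps e t) = t.
  rewrite /unbumps -map_comp -[RHS]map_id; apply/eq_in_map => v /= hv.
  by rewrite unbumpvK //; apply: contra h1 => /eqP<-.
split; rewrite /cons_std ?E //.
apply: std_wordI; first by rewrite -(map_inj_uniq (@bumpv_inj e)) E.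
move=> _ /mapP[v hv ->]; rewrite size_map /unbumpv.
have := std_word_mem v w; rewrite inE hv orbT /=.
have : v != e by apply: contra h1 => /eqP<-.
by case: ifP; lia.
Qed.

(* [D] lists, row by row and in decreasing order, the [j] whose values [j], [j.+1] get exchanged.
   A row starting with the letter [e] has [e] further crossings, which lower [e] to the value 0
   and are left implicit; the letters after [e] are then restandardized. *)
Fixpoint pipe_dream (D : seq (seq nat)) (w : seq nat) :=
  match D, w with
  | [::], [::] => true
  | T :: D', e :: t => is_row e T (unbumps e t) && pipe_dream D' (app_row T (unbumps e t))
  | _, _ => false
  end.

Fixpoint weight (D : seq (seq nat)) (w : seq nat) : seq nat :=
  match D, w with
  | T :: D', e :: t => e + size T :: weight D' (app_row T (unbumps e t))
  | _, _ => [::]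
  end.

Definition weight_inj w := forall D D', pipe_dream D w -> pipe_dream D' w ->
  weight D w = weight D' w -> D = D'.

(** Weight injectivity of [cons_std e t] with the bound e separated from the word t: the inductions
    raise e while t stays fixed. *)
Definition row_weight_inj e t := forall T D T' D',
  is_row e T t -> pipe_dream D (app_row T t) -> is_row e T' t -> pipe_dream D' (app_row T' t) ->
  size T = size T' -> weight D (app_row T t) = weight D' (app_row T' t) -> T = T' /\ D = D'.

Lemma weight_inj_cons_std e t : weight_inj (cons_std e t) <-> row_weight_inj e t.
Proof.
split=> [h T D T' D' r1 p1 r2 p2 s w|h [|T D] [|T' D'] //=].
  have := h (T :: D) (T' :: D'); rewrite /= unbumps_bumpv r1 p1 r2 p2 s w.
  by move=> /(_ erefl erefl erefl) [-> ->].
by rewrite unbumps_bumpv => /andP[r1 p1] /andP[r2 p2] [/addnI s w]; case: (h T D T' D') => // -> ->.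
Qed.

(** * Occurrences of patterns in words *)

Definition occurs (t s : seq nat) := all (mem t) s && sorted ltn (map (index^~ t) s).

(* The letters of [s], listed in the order of the values of [sg], increase. *)
Definition order_iso (sg s : seq nat) :=
  (size s == size sg) && sorted ltn [seq nth 0 s (index k sg) | k <- iota 1 (size sg)].

Definition bad t := exists sg s, [/\ sg \in zero_one_patterns, occurs t s & order_iso sg s].

(* Patterns of [cons_std e t] that use its first letter. As [t] is standardized without [e], the letter
   [e] lies between the letters [e.-1] and [e] of [t]; the doubling makes room for it. *)
Definition bad_cons e t := exists sg s, [/\ sg \in zero_one_patterns, occurs t s &
  order_iso sg (e.*2 :: map (fun v => v.*2.+1) s)].

Lemma patterns_perm sg : sg \in zero_one_patterns -> perm_eq sg (iota 1 (size sg)).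
Proof.
have /allP H : all (fun sg => perm_eq sg (iota 1 (size sg))) zero_one_patterns by [].
exact: H.
Qed.

Lemma sorted_map_in (T : eqType) (f : T -> nat) (g : nat -> nat) (s : seq T) :
  (forall u v, u \in s -> v \in s -> f u < f v -> g (f u) < g (f v)) ->
  sorted ltn (map f s) -> sorted ltn (map (g \o f) s).
Proof.
rewrite !sorted_map; case: s => // x s h /=.
elim: s x h => //= y s IH x h /andP[h1 h2].
rewrite /= h ?inE ?eqxx ?orbT //=.
by apply: IH => // u v hu hv; apply: h; rewrite inE ?hu ?hv orbT.
Qed.

Lemma order_iso_map (f : nat -> nat) sg s : sg \in zero_one_patterns ->
  {in s &, forall u v, u < v -> f u < f v} -> order_iso sg s -> order_iso sg (map f s).
Proof.
move=> hs hf /andP[/eqP h1 h2]; rewrite /order_iso size_map h1 eqxx /=.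
have hi k : k \in iota 1 (size sg) -> index k sg < size s.
  by rewrite -(perm_mem (patterns_perm hs)) h1 index_mem.
rewrite (_ : map _ _ = map (f \o (fun k => nth 0 s (index k sg))) (iota 1 (size sg))); last first.
  by apply/eq_in_map => k hk /=; rewrite (nth_map 0) ?hi.
by apply: sorted_map_in h2 => u v hu hv; apply: hf; rewrite mem_nth ?hi.
Qed.

Lemma occurs_app_row T t s : occurs (app_row T t) (map (act_row T) s) = occurs t s.
Proof.
rewrite /occurs all_map -map_comp; congr (_ && _).
  by apply: eq_all => v /=; rewrite mem_app_row.
by congr (sorted _ _); apply: eq_map => v /=; rewrite index_app_row.
Qed.

Lemma index_cons_std e t v : index (bumpv e v) (cons_std e t) = (index v t).+1.
Proof.
rewrite /cons_std /= eq_sym (negbTE (bumpv_neq e v)) index_map //; exact: bumpv_inj.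
Qed.

Lemma mem_cons_std e t v : (bumpv e v \in cons_std e t) = (v \in t).
Proof. by rewrite inE (negbTE (bumpv_neq e v)) mem_map //; apply: bumpv_inj. Qed.

Lemma occurs_cons_std e t s : occurs (cons_std e t) (map (bumpv e) s) = occurs t s.
Proof.
rewrite /occurs all_map -map_comp; congr (_ && _).
  by apply: eq_all => v /=; exact: mem_cons_std.
rewrite (_ : map _ s = map succn (map (index^~ t) s)); last first.
  by rewrite -map_comp; apply: eq_map => v; exact: index_cons_std.
by rewrite sorted_map; apply: eq_sorted.
Qed.

Lemma occurs_cons t v s : occurs t (v :: s) ->
  [/\ v \in t, occurs t s & {in s, forall u, index v t < index u t}].
Proof.
move=> /andP[/= /andP[h1 h2] h3]; split=> //.
  by rewrite /occurs h2 (path_sorted h3).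
move=> u hu; have := order_path_min ltn_trans h3 => /allP; apply.
exact: map_f.
Qed.

Lemma occurs_consI t v s : v \in t -> occurs t s -> {in s, forall u, index v t < index u t} ->
  occurs t (v :: s).
Proof.
move=> h1 /andP[h2 h3] h4; rewrite /occurs /= h1 h2 /= path_min_sorted //.
by apply/allP => _ /mapP[u hu ->]; apply: h4.
Qed.

Lemma map_bumpv_mem e t s : e \notin s -> all (mem (cons_std e t)) s ->
  exists s0, s = map (bumpv e) s0.
Proof.
move=> hs /allP h; exists (map (unbumpv e) s).
rewrite -map_comp -[LHS]map_id; apply/eq_in_map => v hv /=.
by rewrite unbumpvK //; apply: contra hs => /eqP<-.
Qed.

(** On both sides the letters of s below e are below the first letter and the others above it; f is
    the order-preserving relabelling in either direction. *)
Lemma dbl_cons_std sg e s : sg \in zero_one_patterns ->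
  order_iso sg (e :: map (bumpv e) s) <-> order_iso sg (e.*2 :: map (fun v => v.*2.+1) s).
Proof.
move=> hs; split=> h.
  pose f v := if v == e then e.*2 else (unbumpv e v).*2.+1.
  have -> : e.*2 :: [seq v.*2.+1 | v <- s] = map f (e :: map (bumpv e) s).
    rewrite /= {1}/f eqxx -map_comp; congr cons.
    by apply: eq_map => v /=; rewrite /f (negbTE (bumpv_neq e v)) bumpvK.
  by apply: order_iso_map h => // u v _ _; rewrite /f /unbumpv; do !case: ifP; lia.
pose f v := if v == e.*2 then e else bumpv e v./2.
have -> : e :: map (bumpv e) s = map f (e.*2 :: [seq v.*2.+1 | v <- s]).
  rewrite /= {1}/f eqxx -map_comp; congr cons.
  apply: eq_map => v /=; rewrite /f /=; case: eqP; first lia.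
  by rewrite uphalf_double.
apply: order_iso_map h => // u v; rewrite !inE.
by move=> /orP[/eqP->|/mapP[u' _ ->]] /orP[/eqP->|/mapP[v' _ ->]];
  rewrite /f /bumpv /= ?uphalf_double; do !case: ifP; lia.
Qed.

Lemma bad_cons_std e t : bad (cons_std e t) <-> bad t \/ bad_cons e t.
Proof.
split=> [[sg [s [hs ho hc]]]|[[sg [s [hs ho hc]]]|[sg [s [hs ho hc]]]]].
- have [he|he] := boolP (e \in s).
    (* The letter e has index 0, so it can only be the first letter of an occurrence. *)
    case: s ho hc he => // v s ho hc he.
    have [hv ho' hlt] := occurs_cons ho.
    have ev : v = e.
      move: he; rewrite inE => /orP[/eqP->//|/hlt].
      by rewrite /= eqxx ltn0.
    move: he ho hc => _; rewrite {}ev in hlt *.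
    have he : e \notin s by apply/negP => /hlt; rewrite ltnn.
    move=> ho hc; move: ho' => /andP[ha _].
    have [s0 es] := map_bumpv_mem he ha; subst s.
    right; exists sg, s0; split=> //; last by apply/dbl_cons_std.
    by have [_ + _] := occurs_cons ho; rewrite occurs_cons_std.
  move: (ho) => /andP[ha _].
  have [s0 es] := map_bumpv_mem he ha; subst s; left.
  exists sg, s0; split=> //; first by rewrite -(occurs_cons_std e).
  have -> : s0 = map (unbumpv e) (map (bumpv e) s0).
    by rewrite -map_comp -[LHS]map_id; apply: eq_map => v /=; rewrite bumpvK.
  by apply: order_iso_map hc => // _ _ /mapP[u _ ->] /mapP[v _ ->]; rewrite ltn_bumpv !bumpvK.
- exists sg, (map (bumpv e) s); split; rewrite ?occurs_cons_std //.
  by apply: order_iso_map hc => // u v _ _; rewrite ltn_bumpv.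
exists sg, (e :: map (bumpv e) s); split=> //; last by apply/dbl_cons_std.
apply: occurs_consI; rewrite ?inE ?eqxx ?occurs_cons_std //.
by move=> _ /mapP[v _ ->]; rewrite index_cons_std /= eqxx.
Qed.

Lemma gtn_trans : transitive gtn.
Proof. by move=> y x z /=; lia. Qed.

Lemma row_cons lo j T t :
  is_row lo (j :: T) t = [&& lo <= j, invv j t, all (gtn j) T & is_row lo T (swapv j t)].
Proof.
rewrite /is_row /= (path_sortedE gtn_trans).
by case: (lo <= j); case: (invv j t); case: (all (gtn j) T); case: (sorted gtn T);
  case: (all (leq lo) T).
Qed.

(** The row a + k - 1, ..., a, which slides the letter a + k down to a and raises the letters in
    between by one. *)
Fixpoint downto k a := if k is k'.+1 then a + k' :: downto k' a else [::].

Lemma size_downto k a : size (downto k a) = k.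
Proof. by elim: k => //= k ->. Qed.

Lemma all_downto k a : all (gtn (a + k)) (downto k a).
Proof.
elim: k => //= k IH; apply/andP; split; first by rewrite /=; lia.
by apply: sub_all IH => j /=; lia.
Qed.

Lemma row_downto lo k a t : lo <= a ->
  (forall v, a <= v < a + k -> index (a + k) t < index v t) ->
  is_row lo (downto k a) t.
Proof.
move=> hlo; elim: k t => // k IH t h; rewrite [downto _ _]/= row_cons.
apply/and4P; split; first by lia.
- by rewrite /invv -addnS; apply: h; lia.
- exact: all_downto.
apply: IH => v hv; rewrite !index_swapv tauL -addnS tau_far; try lia.
by apply: h; lia.
Qed.

Lemma act_row_downto k a v :
  act_row (downto k a) v = if v == a + k then a else if a <= v < a + k then v.+1 else v.
Proof.
elim: k v => [|k IH] v; first by rewrite /act_row /=; do !case: ifP; lia.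
by rewrite /act_row /= -/(act_row _ _) IH /tau; do !case: ifP; lia.
Qed.

Lemma row_weight_inj_child e T t : is_row e T t -> row_weight_inj e t -> weight_inj (app_row T t).
Proof. by move=> r z D D' p p' h; have [] := z T D T D' r p r p' erefl h. Qed.

(** * Lehmer codes, the weights of bottom pipe dreams *)

Definition code (v : seq nat) i := count (fun u => u < nth 0 v i) (drop i.+1 v).

Lemma mkseqS (T : Type) (f : nat -> T) n : mkseq f n.+1 = f 0 :: mkseq (fun i => f i.+1) n.
Proof. by rewrite /mkseq /= -[1]addn0 iotaDl -map_comp. Qed.

Lemma count_iota_lt e n : e <= n -> count (fun u => u < e) (iota 0 n) = e.
Proof.
move=> h; rewrite -(subnKC h) iotaD count_cat add0n.
rewrite (eq_in_count (a2 := predT)); last by move=> v; rewrite mem_iota => /=.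
rewrite count_predT size_iota (eq_in_count (a2 := pred0)); first by rewrite count_pred0 addn0.
by move=> v; rewrite mem_iota /=; lia.
Qed.

Lemma code_cons_std0 e t : e <= size t -> std_word t -> code (cons_std e t) 0 = e.
Proof.
move=> he w; rewrite /code /= drop0 count_map.
rewrite (eq_count (a2 := fun u => u < e)); last by move=> v /=; rewrite ltn_bumpvL.
by rewrite (seq.permP w) count_iota_lt.
Qed.

Lemma code_cons_stdS e t i : i < size t -> code (cons_std e t) i.+1 = code t i.
Proof.
move=> hi; rewrite /code /= -map_drop count_map (nth_map 0) //.
by apply: eq_count => v /=; rewrite ltn_bumpv.
Qed.

Lemma pd_nil w : pipe_dream (nseq (size w) [::]) w.
Proof.
move: {-1}(size w) (erefl (size w)) => n; elim: n w => [|n IH] [|e t] //= [h].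
by rewrite IH // size_map.
Qed.

(** Only the implicit crossings remain, and a first letter e has exactly e smaller letters after
    it. *)
Lemma weight_nil w : std_word w -> weight (nseq (size w) [::]) w = mkseq (code w) (size w).
Proof.
move: {-1}(size w) (erefl (size w)) => n; elim: n w => [|n IH] [|e t] //= [h] w.
have [he wt' E] := std_word_cons w;
  rewrite addn0 IH ?size_map // E mkseqS code_cons_std0 ?size_map //.
congr cons; apply/eq_in_map => i; rewrite mem_iota /= add0n => hi.
by rewrite code_cons_stdS ?size_map // h.
Qed.

Lemma in_drop (t : seq nat) m u : uniq t -> u \in t -> (u \in drop m t) = (m <= index u t).
Proof.
move=> hu hin; rewrite -{1}(cat_take_drop m t) in hu.
move: hu; rewrite cat_uniq => /and3P[_ /hasPn h _].
have [hm|hm] := leqP (size t) m.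
  by rewrite drop_oversize // in_nil; apply/esym/negbTE;
    rewrite -ltnNge (leq_trans _ hm) ?index_mem.
have e : size (take m t) = m by rewrite size_take hm.
rewrite -{2}(cat_take_drop m t) index_cat.
case: ifP => h1; last first.
  rewrite e leq_addr; move: hin; rewrite -{1}(cat_take_drop m t) mem_cat h1.
  by case: (u \in _).
have := h1; rewrite -index_mem e => h2; rewrite leqNgt h2.
by apply/negP => /h; rewrite /= h1.
Qed.

(** Only the inversion between y.+1 and y disappears, and it was counted at the position of y.+1,
    which stands first. *)
Lemma code_swapv y t m : std_word t -> invv y t ->
  code (swapv y t) m + (m == index y.+1 t) = code t m.
Proof.
move=> w hi; have u := std_word_uniq w; have hy1 := invv_mem hi.
have hy : y \in t by move: hy1; rewrite !std_word_mem //; lia.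
have [hm|hm] := leqP (size t) m.
  have : m != index y.+1 t by apply/eqP => E; move: hm; rewrite E leqNgt index_mem hy1.
  by move/negbTE->; rewrite /code !drop_oversize // ?size_swapv; lia.
set x := nth 0 t m; have hx : x \in t by rewrite mem_nth.
have ix : index x t = m by rewrite index_uniq.
rewrite /code (nth_map 0) // -/x -map_drop count_map.
have D v : v \in drop m.+1 t -> v \in t /\ m < index v t.
  by move=> hv; have hv' := mem_drop hv; split=> //; rewrite -in_drop.
have [E|E] := eqVneq x y.+1.
  have em : index y.+1 t = m by rewrite -E ix.
  rewrite E em eqxx tauR.
  rewrite (eq_in_count (a2 := fun v => v < y)); last first.
    move=> v /D [_ h] /=; have : v != y.+1 by apply/eqP => ev; move: h; rewrite ev em ltnn.
    by rewrite /tau; do !case: ifP; lia.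
  (* The letters below y.+1 are those below y together with y, which occurs once to the right of
     position m. *)
  have := count_predUI (fun v => v < y) (pred1 y) (drop m.+1 t).
  rewrite (eq_count (a1 := predU _ _) (a2 := fun v => v < y.+1)); last by move=> v /=; lia.
  rewrite (eq_count (a1 := predI _ _) (a2 := pred0)); last by move=> v /=; lia.
  rewrite count_pred0 addn0 count_uniq_mem ?drop_uniq // in_drop //.
  by move: hi; rewrite /invv em => -> ->.
have -> : (m == index y.+1 t) = false.
  by apply/negP => /eqP h; case/eqP: E; apply: (index_inj hx); rewrite ix.
rewrite addn0; apply: eq_in_count => v /D [hv hlt] /=.
have nv : v != x by apply/eqP => e; move: hlt; rewrite e ix ltnn.
have [ey|ny] := eqVneq x y; last by rewrite /tau; do !case: ifP; lia.
have nv1 : v != y.+1.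
  by apply/eqP => e; move: hlt hi; rewrite /invv e -ix ey; lia.
by rewrite ey tauL tau_far ?ey //; [lia | rewrite -ey].
Qed.

(** Discrete intermediate values: going down from x to c, the positions pass from at most j to
    beyond j between two consecutive values. *)
Lemma switch_value (t : seq nat) j c x : c < x -> index x t <= j < index c t ->
  exists y, [/\ c <= y < x, j < index y t & index y.+1 t <= j].
Proof.
move=> hx; have [k hk] : exists k, x = c + k.+1 by exists (x - c).-1; lia.
elim: k c x hk hx => [|k IH] c x -> hx /andP[h1 h2].
  by rewrite addn1 in h1 *; exists c; split=> //; lia.
have [h|h] := leqP (index c.+1 t) j; first by exists c; split=> //; lia.
have [|||y [? ? ?]] := IH c.+1 (c + k.+2); try lia.
by exists y; split=> //; lia.
Qed.

Lemma nth_swapv j t i : i < size t -> nth 0 (swapv j t) i = tau j (nth 0 t i).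
Proof. exact: nth_map. Qed.

(* [code v] is the weight of the bottom pipe dream; one of its crossings moves up from row j to row i. *)
Lemma pd_move v i j k : std_word v -> i < j -> j < k -> k < size v ->
  nth 0 v i < nth 0 v k < nth 0 v j ->
  exists D, pipe_dream D v /\ weight D v = mkseq (fun m => code v m + (m == i) - (m == j)) (size v).
Proof.
move: {-1}(size v) (erefl (size v)) => n; elim: n v i j k => [|n IH] [|e t] //= i j k [h] w.
have [he w' E] := std_word_cons w; set t' := unbumps e t in w' E *.
have st' : size t' = n by rewrite size_map.
have et : t = map (bumpv e) t' by case: E.
have snth m : m < n -> nth 0 t m = bumpv e (nth 0 t' m).
  by move=> hm; rewrite et (nth_map 0) // st'.
case: j => // j; case: k => // k; rewrite !ltnS /= => hij hjk hk.
case: i hij => [|i] hij /= /andP[h1 h2].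
  (* For i = 0 the first row receives one crossing y, with y.+1 at or before position j and y after
     it. This lowers the code at the position p of y.+1; when p differs from j, the induction
     hypothesis moves a crossing from row j to row p. *)
  rewrite !snth // in h1 h2; last lia.
  rewrite ltn_bumpvR in h1; rewrite ltn_bumpv in h2.
  have u' := std_word_uniq w'.
  have ij : index (nth 0 t' j) t' = j by rewrite index_uniq // st'; lia.
  have ik : index (nth 0 t' k) t' = k by rewrite index_uniq // st'; lia.
  have [|y [hy1 hy2 hy3]] := @switch_value t' j _ _ h2; first by rewrite ij ik leqnn.
  have hi : invv y t' by rewrite /invv; lia.
  have ws := std_word_swapv w' hi.
  have hr : is_row e [:: y] t' by rewrite row_cons hi /is_row /= !andbT;
    case/andP: hy1 => /(leq_trans h1).
  set p := index y.+1 t'.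
  have hp : p < n by rewrite -st' index_mem invv_mem.
  suff [D [D1 D2]] : exists D, pipe_dream D (swapv y t') /\
     weight D (swapv y t') = mkseq (fun m => code t' m - (m == j)) n.
    exists ([:: y] :: D); rewrite /= hr; split=> //=;
      rewrite D2 E mkseqS /= code_cons_std0 ?st' -?h //.
    rewrite subn0; congr cons; apply/eq_in_map => i; rewrite mem_iota add0n /= => hi'.
    by rewrite code_cons_stdS ?st' -?h //= addn0.
  have [ep|np] := eqVneq p j.
    exists (nseq (size (swapv y t')) [::]); rewrite pd_nil weight_nil // size_swapv st'; split=> //.
    by apply: eq_map => m; rewrite -(code_swapv m w' hi) -/p ep addnK.
  have iy : index y t' < n.
    by move: (invv_mem hi); rewrite -st' index_mem !std_word_mem //; apply: ltnW.
  (* After the swap the letters at p, at the former place of y and at j are y, y.+1 and a larger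
     one, as a move requires. *)
  have [||||||D [D1 D2]] := IH (swapv y t') p j (index y t').
  - by rewrite size_swapv.
  - exact: ws.
  - by rewrite ltn_neqAle np.
  - exact: hy2.
  - exact: iy.
  - rewrite !nth_swapv ?st' //; last lia.
    rewrite !nth_index ?invv_mem -?index_mem ?st' // tauL tauR.
    have : nth 0 t' j != y.+1 by apply: contra np => /eqP e'; rewrite /p -e' ij.
    by move=> ?; rewrite tau_far; lia.
  exists D; split=> //; rewrite D2; apply: eq_map => m.
  by rewrite -(code_swapv m w' hi) -/p; lia.
(* For i > 0 the first row stays empty and the move takes place in the remaining word. *)
have hj := ltn_trans hjk hk; have hi := ltn_trans hij hj.
rewrite !snth // in h1 h2.
rewrite !ltn_bumpv in h1 h2.
have [|D [D1 D2]] := IH t' i j k st' w' hij hjk hk; first by rewrite h1.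
exists ([::] :: D); rewrite /= /is_row /=; split=> //;
  rewrite D2 E mkseqS code_cons_std0 ?st' -?h // addn0 subn0.
congr cons; apply/eq_in_map => m; rewrite mem_iota add0n /= => hm.
by rewrite code_cons_stdS ?st' -?h.
Qed.

Arguments cons_std : simpl never.
Arguments app_row : simpl never.
Arguments swapv : simpl never.

Lemma row1 e j t : e <= j -> invv j t -> is_row e [:: j] t.
Proof. by move=> h1 h2; rewrite row_cons h1 h2. Qed.

Lemma pd_move_val v x y z : std_word v -> x \in v -> y \in v -> z \in v ->
  index x v < index y v < index z v -> x < z < y ->
  exists D, pipe_dream D v /\
    weight D v = mkseq (fun m => code v m + (m == index x v) - (m == index y v)) (size v).
Proof.
move=> w hx hy hz /andP[h1 h2] h.
by apply: (@pd_move v _ _ (index z v)); rewrite ?index_mem ?nth_index.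
Qed.

Lemma invv_mem2 j t : std_word t -> invv j t -> j \in t /\ j.+1 \in t.
Proof. by move=> w /invv_mem h; split=> //; move: h; rewrite !std_word_mem //; apply: ltnW. Qed.

(* The rows [:: d] and [:: c] share the weight of the bottom pipe dream below [:: c]. *)
Lemma not_row_weight_inj_nested e t c d : std_word t -> e <= d -> d < c -> invv d t -> invv c t ->
  index d.+1 t < index c.+1 t -> ~ row_weight_inj e t.
Proof.
move=> w he hdc hd hc hlt hZ.
have [hd0 hd1] := invv_mem2 w hd; have [hc0 hc1] := invv_mem2 w hc.
have ncd : c != d.+1 by apply/eqP => E; move: hc; rewrite /invv E in hlt *; lia.
(* Swapping d costs one at the row of d.+1; moving a crossing there from the row of c.+1 restores it
   and leaves the cost at c.+1. *)
have [] := @pd_move_val (swapv d t) d c.+1 c; first exact: std_word_swapv.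
- by rewrite mem_swapv tauL.
- by rewrite mem_swapv tau_far //; clear -ncd hdc; lia.
- by rewrite mem_swapv tau_far //; clear -ncd hdc; lia.
- by rewrite !index_swapv tauL !tau_far ?hlt //; clear -ncd hdc; lia.
- by clear -hdc; lia.
move=> D []; rewrite size_swapv !index_swapv tauL tau_far; try (clear -ncd hdc; lia).
move=> D1 D2.
have r1 : is_row e [:: d] t by apply: row1.
have r2 : is_row e [:: c] t by apply: row1 => //; clear -he hdc; lia.
have [|[E] _] := hZ [:: d] D [:: c] (nseq (size (swapv c t)) [::]) r1 D1 r2 (pd_nil _) erefl;
  last by clear -E hdc; lia.
rewrite D2 weight_nil ?size_swapv //; last exact: std_word_swapv.
apply: eq_map => m; have := code_swapv m w hd; have := code_swapv m w hc.
by clear -hlt; case: eqP; case: eqP; lia.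
Qed.

(* Moving a crossing up to the row of [z] makes the weights below [:: d] and [:: c] equal. *)
Lemma not_row_weight_inj_shared e t c d z : std_word t -> e <= c -> c < d -> invv d t -> invv c t ->
  z \in t -> z < c -> index z t < index c.+1 t -> index z t < index d.+1 t -> ~ row_weight_inj e t.
Proof.
move=> w he hdc hd hc hz hzc hlt1 hlt2 hZ.
have [hd0 hd1] := invv_mem2 w hd; have [hc0 hc1] := invv_mem2 w hc.
(* Both pipe dreams get the code of t, increased by one at the row of z and decreased by one at the
   rows of c.+1 and d.+1. The [tau] covers the case d = c.+1. *)
have [] := @pd_move_val (swapv d t) z (tau d c.+1) c; first exact: std_word_swapv.
- by rewrite mem_swapv tau_far //; clear -hdc hzc; lia.
- by rewrite mem_swapv tauK.
- by rewrite mem_swapv tau_far //; clear -hdc hzc; lia.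
- by rewrite !index_swapv tauK !tau_far ?hlt1 //; clear -hdc hzc; lia.
- by clear -hdc hzc; rewrite /tau; do !case: ifP; lia.
move=> D []; rewrite size_swapv !index_swapv tauK tau_far; try (clear -hdc hzc; lia).
move=> D1 D2.
have [] := @pd_move_val (swapv c t) z d.+1 (tau c d); first exact: std_word_swapv.
- by rewrite mem_swapv tau_far //; clear -hdc hzc; lia.
- by rewrite mem_swapv tau_far //; clear -hdc hzc; lia.
- by rewrite mem_swapv tauK.
- by rewrite !index_swapv tauK !tau_far ?hlt2 //; clear -hdc hzc; lia.
- by clear -hdc hzc; rewrite /tau; do !case: ifP; lia.
move=> D' []; rewrite size_swapv !index_swapv (@tau_far c d.+1); try (clear -hdc hzc; lia).
rewrite tau_far; try (clear -hdc hzc; lia).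
move=> D1' D2'.
have r1 : is_row e [:: d] t by apply: row1 => //; clear -hdc he; lia.
have r2 : is_row e [:: c] t by apply: row1.
have npp : index c.+1 t != index d.+1 t.
  by apply/eqP => /(index_inj hc1); clear -hdc; lia.
have [|[E] _] := hZ [:: d] D [:: c] D' r1 D1 r2 D1' erefl; last by clear -E hdc; lia.
rewrite D2 D2'.
apply: eq_map => m; have := code_swapv m w hd; have := code_swapv m w hc.
by clear -npp; do !case: eqP; lia.
Qed.

(** * Rows of a word with a prefixed letter *)

Lemma bumpv_lt a v : v < a -> bumpv a v = v.
Proof. by rewrite /bumpv; case: ifP; lia. Qed.

Lemma bumpv_ge a v : a <= v -> bumpv a v = v.+1.
Proof. by rewrite /bumpv; case: ifP. Qed.

Lemma swapv_cons_std a t : swapv a (cons_std a.+1 t) = cons_std a t.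
Proof.
rewrite /swapv /cons_std /= tauR -map_comp; congr cons; apply: eq_map => v /=.
by rewrite /tau /bumpv; do !case: ifP; lia.
Qed.

Lemma swapv_cons_std_lt a j t : j.+1 < a -> swapv j (cons_std a t) = cons_std a (swapv j t).
Proof.
move=> h; rewrite /swapv /cons_std /= tau_far; try lia.
rewrite -!map_comp; congr cons; apply: eq_map => v /=.
by rewrite /tau /bumpv; do !case: ifP; lia.
Qed.

Lemma invv_cons_std_lt a j t : j.+1 < a -> invv j (cons_std a t) = invv j t.
Proof.
move=> h; have := index_cons_std a t j; have := index_cons_std a t j.+1.
by rewrite !bumpv_lt ?(ltnW h) // /invv => -> ->.
Qed.

Lemma swapv_cons_std_ge a j t : a <= j -> swapv j.+1 (cons_std a t) = cons_std a (swapv j t).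
Proof.
move=> h; rewrite /swapv /cons_std /= tau_far; try lia.
rewrite -!map_comp; congr cons; apply: eq_map => v /=.
by rewrite /tau /bumpv; do !case: ifP; lia.
Qed.

Lemma invv_cons_std_ge a j t : a <= j -> invv j.+1 (cons_std a t) = invv j t.
Proof.
move=> h; have := index_cons_std a t j; have := index_cons_std a t j.+1.
by rewrite !bumpv_ge ?(leqW h) // /invv => -> ->.
Qed.

Lemma app_row_cons j T t : app_row (j :: T) t = app_row T (swapv j t). Proof. by []. Qed.

Lemma app_row_cons_std a T t : all (fun j => j.+1 < a) T ->
  app_row T (cons_std a t) = cons_std a (app_row T t).
Proof.
elim: T t => // j T IH t; rewrite [all _ _]/= => /andP[h1 h2].
by rewrite !app_row_cons swapv_cons_std_lt // IH.
Qed.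

Lemma run_cons_std a T t : all (fun j => j.+1 < a) T -> run_row T (cons_std a t) = run_row T t.
Proof.
elim: T t => //= j T IH t /andP[h1 h2].
by rewrite swapv_cons_std_lt // invv_cons_std_lt // IH.
Qed.

(** Since a row decreases, the front letter slides down in one unbroken run; once it rests at a, all
    later swaps exchange values below a and act on t alone. *)
Lemma row_cons_std e b t T : e <= b -> all (gtn b) T -> is_row e T (cons_std b t) ->
  exists a T1, [/\ e <= a <= b, T = downto (b - a) a ++ T1, all (fun j => j.+1 < a) T1,
    is_row e T1 t & app_row T (cons_std b t) = cons_std a (app_row T1 t)].
Proof.
elim: b T => [|b IH] [|j T] hb hT hr.
- by exists 0, [::]; split; rewrite ?hb.
- by move: hT.
- by exists b.+1, [::]; split; rewrite ?subnn ?hb /=.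
move: (hr); rewrite row_cons => /and4P[h1 h2 h3 h4].
move: hT => /= /andP[hj hT].
have [E|N] := eqVneq j b.
  subst j; rewrite swapv_cons_std in h4.
  have [a [T1 [a1 a2 a3 a4 a5]]] := IH T h1 h3 h4.
  exists a, T1; split=> //; try lia.
  - have ha : a <= b by lia.
    by rewrite {1}a2 subSn //= subnKC.
  - by rewrite app_row_cons swapv_cons_std a5.
have hall : all (fun i => i.+1 < b.+1) (j :: T).
  rewrite /= ; apply/andP; split; first lia.
  by apply: sub_all h3 => i /=; lia.
exists b.+1, (j :: T); split=> //; try lia.
- by rewrite subnn.
- by move: hr; rewrite /is_row run_cons_std.
- exact: app_row_cons_std.
Qed.

Lemma invv_app_row_below a T j t : all (leq a) T -> j.+1 < a -> invv j (app_row T t) = invv j t.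
Proof.
move=> hT h; have := index_app_row T j t; have := index_app_row T j.+1 t.
by rewrite !(act_row_below hT) ?(ltnW h) // /invv => -> ->.
Qed.

Lemma swapv_app_row a T j t : all (leq a) T -> j.+1 < a ->
  swapv j (app_row T t) = app_row T (swapv j t).
Proof.
move=> + h; elim: T t => // k T IH t; rewrite [all _ _]/= => /andP[h1 h2].
by rewrite !app_row_cons IH // swapv_comm //; lia.
Qed.

Lemma run_swapv a T j t : all (leq a) T -> j.+1 < a -> run_row T (swapv j t) = run_row T t.
Proof.
move=> + h; elim: T t => //= k T IH t /andP[h1 h2].
rewrite -swapv_comm ?IH //; last lia.
by rewrite /invv !index_swapv !tau_far //; lia.
Qed.

(** The two rows exchange values in disjoint ranges. *)
Lemma run_comm a T1 T2 t : all (fun j => j.+1 < a) T1 -> all (leq a) T2 ->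
  [/\ run_row T2 (app_row T1 t) = run_row T2 t, run_row T1 (app_row T2 t) = run_row T1 t
   & app_row T2 (app_row T1 t) = app_row T1 (app_row T2 t)].
Proof.
move=> + h2; elim: T1 t => // j T1 IH t; rewrite [all _ _]/= => /andP[h h1].
rewrite !app_row_cons /=; have [-> r2 ->] := IH (swapv j t) h1.
by rewrite (run_swapv _ h2 h) (invv_app_row_below _ h2 h) (swapv_app_row _ h2 h) r2.
Qed.

Lemma sorted_cat_gtn T1 T2 a : all (gtn a) T1 -> all (leq a) T2 ->
  sorted gtn T1 -> sorted gtn T2 -> sorted gtn (T2 ++ T1).
Proof.
move=> h1 h2 s1 s2; rewrite sorted_pairwise; last exact: gtn_trans.
rewrite pairwise_cat -!sorted_pairwise ?s1 ?s2 ?andbT; try exact: gtn_trans.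
apply/allrelP => x y /(allP h2) hx /(allP h1) /=; lia.
Qed.

(** If a < a', the entries from a on would be those of T2' and at most a'.-1 - a entries of T1',
    since a'.-1 itself is excluded; equality of the sums requires one more. *)
Lemma count_split (T1 T2 T1' T2' : seq nat) a a' :
  uniq (T2 ++ T1) -> T2 ++ T1 = T2' ++ T1' -> all (leq a) T2 -> all (fun j => j.+1 < a) T1 ->
  all (leq a') T2' -> all (fun j => j.+1 < a') T1' -> a + size T2 = a' + size T2' -> a' <= a.
Proof.
move=> u E h2 h1 h2' h1' hs; rewrite leqNgt; apply/negP => hlt.
have c : count (leq a) (T2 ++ T1) = size T2.
  rewrite count_cat (eq_in_count (a1 := leq a) (a2 := predT) (s := T2));
    last by move=> v /(allP h2) ->.
  rewrite count_predT (eq_in_count (a2 := pred0)) ?count_pred0 ?addn0 // => v /(allP h1) /=; lia.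
have c' : count (leq a) T2' = size T2'.
  by rewrite (eq_in_count (a2 := predT)) ?count_predT // => v /(allP h2') /=; lia.
move: c; rewrite E count_cat c'.
have : count (leq a) T1' <= size (iota a (a'.-1 - a)).
  rewrite -size_filter; apply: uniq_leq_size.
    by move: u; rewrite E cat_uniq => /and3P[_ _ u]; apply: filter_uniq.
  by move=> v; rewrite mem_filter mem_iota => /andP[h /(allP h1')]; lia.
rewrite size_iota; lia.
Qed.

(* A first row slides [b] to some [a] and then swaps values below [a]; the second row swaps values
   above [a]. Their union is a first row of the word without [b], and the weight determines [a]. *)
Lemma row_weight_inj_insert e b t : e <= b -> (forall j, b <= j -> ~~ invv j (cons_std b t)) ->
  row_weight_inj e t -> row_weight_inj e (cons_std b t).
Proof.
move=> heb hl hZ.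
(* The first swap of a row needs an inversion of the word itself, hence lies below b, and the later
   ones are smaller still. *)
have below T : is_row e T (cons_std b t) -> all (gtn b) T.
  case: T => // j T; rewrite row_cons => /and4P[_ h1 h2 _].
  have hj : j < b by rewrite ltnNge; apply: contraL h1; apply: hl.
  by rewrite /= hj; apply: sub_all h2 => i /=; lia.
(* The row from a on commutes past the row below a, so the two merge into one decreasing row of
   t. *)
have two a T1 T2 : all (fun j => j.+1 < a) T1 -> is_row e T1 t -> e <= a ->
  is_row a T2 (app_row T1 t) ->
    [/\ is_row e (T2 ++ T1) t, app_row T2 (app_row T1 t) = app_row (T2 ++ T1) t & all (leq a) T2].
  move=> h1 /and3P[s1 e1 r1] hea /and3P[s2 e2 r2].
  have [q1 q2 q3] := run_comm t h1 e2.
  split=> //; last by rewrite app_row_cat.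
  rewrite /is_row run_cat q2 r1 -q1 r2 all_cat e1 andbT /=; apply/and3P; split=> //.
    by apply: (@sorted_cat_gtn _ _ a) => //; apply: sub_all h1 => i /=; lia.
  by apply: sub_all e2 => i /=; lia.
move=> T D T' D' r p r' p' hs hw.
have [a [T1 [a1 a2 a3 a4 a5]]] := row_cons_std heb (below _ r) r.
have [a' [T1' [b1 b2 b3 b4 b5]]] := row_cons_std heb (below _ r') r'.
rewrite {}a5 in p hw; rewrite {}b5 in p' hw.
case: D p hw => // T2 D /=; rewrite unbumps_bumpv => /andP[r2 p].
case: D' p' => // T2' D' /=; rewrite unbumps_bumpv => /andP[r2' p'] [hw1 hw2].
have [c1 c2 c3] := two _ _ _ a3 a4 (proj1 (andP a1)) r2.
have [d1 d2 d3] := two _ _ _ b3 b4 (proj1 (andP b1)) r2'.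
rewrite c2 in p hw2; rewrite d2 in p' hw2.
move: hs; rewrite a2 b2 !size_cat !size_downto => hs.
have [|E ED] := hZ _ _ _ _ c1 p d1 p' _ hw2; first by clear -hs hw1 a1 b1; rewrite !size_cat; lia.
have u : uniq (T2 ++ T1).
  by case/and3P: c1 => /(sorted_uniq gtn_trans) -> // x; rewrite /= ltnn.
(* The second weight entry is a + size T2, which fixes where the merged row splits. *)
have ea : a = a'.
  have := count_split u E c3 a3 d3 b3 hw1.
  have := count_split _ (esym E) d3 b3 c3 a3 (esym hw1); rewrite -E => /(_ u); clear; lia.
subst a'; have e2 : size T2 = size T2' by apply: (addnI hw1).
by move/eqP: E; rewrite eqseq_cat // => /andP[/eqP-> /eqP->]; rewrite ED.
Qed.

(** Swaps above e keep e in front of all larger letters, so the swap e never removes an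
    inversion. *)
Lemma row_skip e T t : (forall v, e < v -> index e t < index v t) -> is_row e T t = is_row e.+1 T t.
Proof.
elim: T t => // j T IH t h; rewrite !row_cons.
have [E|N] := eqVneq j e.
  have ni : invv e t = false by apply/negbTE; rewrite /invv -leqNgt ltnW // h.
  by rewrite E ltnn ni andbF.
case: ltngtP N => //= hj _; rewrite IH // => v hv.
rewrite !index_swapv tau_far; try lia.
by apply: h; rewrite /tau; do !case: ifP; lia.
Qed.

Lemma row_weight_inj_skip e t : (forall v, e < v -> index e t < index v t) ->
  row_weight_inj e t <-> row_weight_inj e.+1 t.
Proof. by move=> h; split=> hZ T D T' D'; have := hZ T D T' D'; rewrite !(row_skip _ h). Qed.

(** Among the values from e to b - 1 only b.-1 can be inverted at the start, and swapping j makes at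
    most j.-1 available next. *)
Lemma row_downto_uniq e b T t : all (gtn b) T -> is_row e T t ->
  (forall j, e <= j -> j.+1 < b -> ~~ invv j t) ->
    exists2 a, a + size T = b & T = downto (size T) a.
Proof.
elim: T b t => [|j T IH] b t; first by exists b; rewrite ?addn0.
rewrite row_cons => /= /andP[hj _] /and4P[h1 h2 h3 h4] h.
have E : b = j.+1 by apply/eqP; rewrite eqn_leq hj andbT leqNgt; apply: contraL h2; exact: h.
subst b; have [i i1 i2|a a1 a2] := IH j (swapv j t) h3 h4.
  by rewrite /invv !index_swapv !tau_far; try lia; apply: h => //; lia.
by exists a; rewrite ?addnS ?a1 // {1}a2.
Qed.

(** * Permutations containing a pattern *)

Ltac split_ands := repeat match goal with
  | H : is_true (_ && _) |- _ => let h := fresh in case/andP: H => h H end.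

Definition first_ge (e b : nat) (t : seq nat) :=
  [/\ b \in t, e <= b & forall v, v \in t -> e <= v -> (v == b) || (index b t < index v t)].

Lemma ltn_dblR e v : (e.*2 < v.*2.+1) = (e <= v). Proof. by lia. Qed.
Lemma ltn_dblL e v : (v.*2.+1 < e.*2) = (v < e). Proof. by lia. Qed.
Lemma ltn_dbl u v : (u.*2.+1 < v.*2.+1) = (u < v). Proof. by lia. Qed.
Definition dblE := (ltn_dblR, ltn_dblL, ltn_dbl).

(* [lia] after dropping the hypotheses that slow down its preprocessing. *)
Ltac nlia := repeat match goal with
  | H : is_true (_ \in _) |- _ => clear H
  | H : is_true (occurs _ _) |- _ => clear H
  | H : is_true (order_iso _ _) |- _ => clear H
  | H : is_true (std_word _) |- _ => clear H
  | H : is_true true |- _ => clear H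
  | H : first_ge _ _ _ |- _ => clear H
  | H : forall _, _ |- _ => clear H
  end; lia.

Tactic Notation "open_word" hyp(s) hyp(ho) hyp(hc) simple_intropattern(p) :=
  (destruct s as p; try by [move: hc]);
  let o := fresh "o" in let c := fresh "c" in
  have o := ho; have c := hc; rewrite /occurs /= in o; rewrite /order_iso /= ?dblE in c; split_ands.

Lemma first_geP e t : std_word t -> e < size t -> exists b, first_ge e b t.
Proof.
move=> w he; have hh : has (leq e) t by apply/hasP; exists e => //; rewrite std_word_mem.
have hf := hh; rewrite has_find in hf.
exists (nth 0 t (find (leq e) t)); split; first by rewrite mem_nth.
  exact: nth_find.
move=> v hv hev; case: eqP => //= ne.
rewrite index_uniq ?std_word_uniq // ltn_neqAle; apply/andP; split.
  by apply/eqP => E; apply: ne; rewrite E nth_index.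
rewrite leqNgt; apply/negP => /(before_find 0).
by rewrite nth_index // hev.
Qed.

(** * The slide of b down to a *)

Section Slide.
Variables (e a b : nat).
Hypothesis ha : e <= a <= b.

Let g := act_row (downto (b - a) a).

Lemma slideE v : g v = if v == b then a else if a <= v < b then v.+1 else v.
Proof. by rewrite /g act_row_downto subnKC //; case/andP: ha. Qed.

Lemma slide_b : g b = a. Proof. by rewrite slideE eqxx. Qed.

Lemma slide_ltb v : g v < a -> (v < a) && (v != b).
Proof. by rewrite slideE; do !case: ifP; lia. Qed.

Lemma slide_gtb v : a < g v -> (a <= v) && (v != b).
Proof. by rewrite slideE; do !case: ifP; lia. Qed.

Lemma slide_lt u v : u != b -> v != b -> (g u < g v) = (u < v).
Proof. by rewrite !slideE; do !case: ifP; lia. Qed.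

Lemma slide_low v : v < a -> g v = v.
Proof. by rewrite slideE; do !case: ifP; lia. Qed.

Lemma slide_mid v : a <= v -> v < b -> g v = v.+1.
Proof. by rewrite slideE; do !case: ifP; lia. Qed.

Lemma slide_high v : b < v -> g v = v.
Proof. by rewrite slideE; do !case: ifP; lia. Qed.

Lemma row_slide t : std_word t -> first_ge e b t -> is_row e (downto (b - a) a) t.
Proof.
move=> w fb; case: fb => hb heb h; case/andP: ha => h1 h2.
apply: row_downto => // v; rewrite subnKC // => hv.
have := h v; rewrite std_word_mem //; have := hb; rewrite std_word_mem // => hbs.
by case: eqP; lia.
Qed.

End Slide.

(** Slid down to e, the letter b takes over the role of the removed e: the other letters keep their
    order and their side of e. *)
Lemma bad_slide_e (sg s t : seq nat) (e b : nat) : std_word t -> first_ge e b t ->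
  sg \in zero_one_patterns ->
  occurs t (b :: s) -> order_iso sg (e.*2 :: map (fun v => v.*2.+1) s) ->
  bad (app_row (downto (b - e) e) t).
Proof.
move=> w fb hs ho hc; have [hb heb _] := fb.
have he : e <= e <= b by rewrite leqnn.
exists sg, (map (act_row (downto (b - e) e)) (b :: s)); split=> //; first by rewrite occurs_app_row.
have nb v : v \in s -> v != b.
  by case: (occurs_cons ho) => _ _ h /h; apply: contraTneq => ->; rewrite ltnn.
set g := act_row _; pose f v := if v == e.*2 then e else g v./2.
have -> : map g (b :: s) = map f (e.*2 :: [seq v.*2.+1 | v <- s]).
  rewrite /= {1}/f eqxx /g (slide_b he) -map_comp; congr cons.
  by apply: eq_map => v /=; rewrite /f /= uphalf_double; case: eqP => //; lia.
apply: order_iso_map hc => // u v; rewrite !inE.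
have ff x : f x.*2.+1 = g x by rewrite /f /= uphalf_double; case: eqP => //; lia.
have fe : f e.*2 = e by rewrite /f eqxx.
move=> /orP[/eqP->|/mapP[x hx ->]] /orP[/eqP->|/mapP[y hy ->]]; rewrite ?ff ?fe.
- by rewrite ltnn.
- by move: (nb _ hy); rewrite /g (slideE he); do !case: ifP; lia.
- by move: (nb _ hx); rewrite /g (slideE he); do !case: ifP; lia.
by rewrite /g (slide_lt he) ?nb //; lia.
Qed.

Lemma descent_between (t : seq nat) x y : y < x -> index x t < index y t ->
  exists c, [/\ y <= c < x, invv c t & index c.+1 t <= index x t].
Proof.
move=> h1 h2; have [|c [c1 c2 c3]] := @switch_value t (index x t) y x h1; first by rewrite leqnn.
by exists c; split=> //; rewrite /invv; lia.
Qed.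

Lemma invv_first e b t : std_word t -> first_ge e b t -> e < b -> invv b.-1 t.
Proof.
move=> w [hb heb h] lt; have := h b.-1; move: hb; rewrite /invv !std_word_mem // => hb.
by rewrite prednK; [case: eqP; lia | lia].
Qed.

(** A descent c between y and x and the descent b.-1 give two rows of length one with a common
    monomial, as c.+1 stands after b. *)
Lemma not_row_weight_inj_large e b (t : seq nat) (x y : nat) : std_word t -> first_ge e b t ->
  e < b -> b < y -> y < x ->
  x \in t -> index x t < index y t -> ~ row_weight_inj e t.
Proof.
move=> w fb heb hby hyx hx hi.
have [c [c1 c2 c3]] := descent_between hyx hi.
have hc := invv_mem c2.
have hl : index b t < index c.+1 t.
  by case: fb => _ _ /(_ c.+1 hc); clear -c1 heb hby; case: eqP; lia.
apply: (@not_row_weight_inj_nested e t c b.-1) => //.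
- by clear -heb; lia.
- by clear -heb c1 hby; lia.
- exact: (invv_first w fb).
by rewrite prednK //; clear -heb; lia.
Qed.

(** A descent c among the small letters and the descent b.-1 both have z to the north-west, so a
    crossing can be moved up to its row. *)
Lemma not_row_weight_inj_small e b (t : seq nat) (y v z : nat) : std_word t -> first_ge e b t ->
  e < b -> e <= v -> v < y -> y < b ->
  index y t < index v t -> z \in t -> z < e -> index z t < index b t -> ~ row_weight_inj e t.
Proof.
move=> w fb heb hev hvy hyb hi hz hze hzb.
have [c [c1 c2 c3]] := descent_between hvy hi.
have hl : index b t < index c.+1 t.
  by case: fb => _ _ /(_ c.+1 (invv_mem c2)); clear -c1 hev hyb; case: eqP; lia.
have i2 := invv_first w fb heb.
apply: (@not_row_weight_inj_shared e t c b.-1 z) => //.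
- by clear -hev c1; lia.
- by clear -hyb c1; lia.
- by clear -hze hev c1; lia.
- by clear -hl hzb; lia.
by rewrite prednK //; clear -heb; lia.
Qed.


Lemma bad_occurs t sg s : sg \in zero_one_patterns -> occurs t s -> order_iso sg s -> bad t.
Proof. by exists sg, s. Qed.

Ltac conj := rewrite ?dblE; repeat (apply/andP; split); try done; try nlia.

(** No pattern begins with its largest letter, so t has a letter that is at least e. *)
Lemma bad_cons_lt e t : std_word t -> bad_cons e t -> e < size t.
Proof.
move=> w [sg [s [hs ho hc]]]; move: hs ho hc; rewrite !inE.
by do ![case/orP => [/eqP->|]] => [||||||||||| /eqP->] ho hc;
  (open_word s ho hc [|? [|? [|? [|? [|? [|? ?]]]]]]);
  match goal with H : is_true (?x \in t) |- _ => move: (H); rewrite std_word_mem //; nlia end.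
Qed.

Section BadStep.
Variables (e : nat) (t : seq nat).
Hypothesis w : std_word t.
Hypothesis IH : forall T, is_row e T t -> bad (app_row T t) -> ~ row_weight_inj e t.

(** As the rest of the pattern stands after b, sliding b down to e lets b play the first letter. *)
Lemma not_row_weight_inj_slide b sg s : first_ge e b t -> sg \in zero_one_patterns ->
  occurs t s -> (forall v, v \in s -> index b t < index v t) ->
  order_iso sg (e.*2 :: map (fun v => v.*2.+1) s) -> ~ row_weight_inj e t.
Proof.
move=> fb hs ho hb hc; have [hbt heb _] := fb.
apply: (IH (T := downto (b - e) e)); first by apply: row_slide; rewrite ?leqnn.
by apply: bad_slide_e hc => //; apply: occurs_consI.
Qed.

Lemma not_row_weight_inj_head1 b sg x s : first_ge e b t -> sg \in zero_one_patterns ->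
  occurs t (x :: s) -> e <= x -> x != b ->
  order_iso sg (e.*2 :: map (fun v => v.*2.+1) (x :: s)) -> ~ row_weight_inj e t.
Proof.
move=> fb hs ho hx nx hc; have [hx' _ hl] := occurs_cons ho.
have hb : index b t < index x t by case: fb => _ _ /(_ x hx' hx); rewrite (negbTE nx).
apply: (not_row_weight_inj_slide fb hs ho) => // v; rewrite inE => /orP[/eqP->//|/hl].
exact: ltn_trans.
Qed.

Lemma not_row_weight_inj_below b sg z s : first_ge e b t -> sg \in zero_one_patterns ->
  occurs t (z :: s) -> z < e -> ~~ (index z t < index b t) ->
  order_iso sg (e.*2 :: map (fun v => v.*2.+1) (z :: s)) -> ~ row_weight_inj e t.
Proof.
move=> fb hs ho hz nz hc; have [hz' _ hl] := occurs_cons ho; have [hb heb _] := fb.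
have hlt : index b t < index z t.
  rewrite ltn_neqAle leqNgt nz andbT; apply: contraTneq heb => /(index_inj hb) ->.
  by rewrite -ltnNge.
apply: (not_row_weight_inj_slide fb hs ho) => // v; rewrite inE => /orP[/eqP->//|/hl].
exact: ltn_trans.
Qed.

(* [x], [v], [y] play 5, 6, 4 in 215364, 215634, 315264, 315624 or 315642. Unless a simpler
   coincidence of weights shows up, [b] can replace 5 and sliding it to [a] gives a bad word. *)
Lemma not_row_weight_inj_231 b z x y v : first_ge e b t -> e < b -> z \in t -> z < e ->
  index z t < index b t -> x \in t -> y \in t -> v \in t -> e <= y -> y < x -> y < v ->
  index x t < index y t -> index v t < index y t -> index x t < index v t ->
  forall a, e <= a <= y ->
  (y < b -> b < v -> index b t <= index x t -> bad (app_row (downto (b - a) a) t)) ->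
    ~ row_weight_inj e t.
Proof.
move=> fb heb hz hze hzb hx hy hv hey hyx hyv ixy ivy ixv a ha hbad.
have [hb _ fbP] := fb.
have Ax := fbP x hx; have Ay := fbP y hy; have Av := fbP v hv.
have [hby|hyb] := ltnP b y; first exact: (not_row_weight_inj_large w fb heb hby hyx).
have bx : index b t <= index x t.
  by clear -Ax hey hyx; case: eqP Ax => [->|] //= _ h; apply/ltnW/h; lia.
have nyb : y != b by apply/eqP => E; subst; clear -bx ixy; lia.
have {}hyb : y < b by clear -nyb hyb; lia.
have nvb : v != b by apply/eqP => E; subst; clear -bx ixv; lia.
have [hvb|hvb] := ltnP v b.
  exact: (not_row_weight_inj_small w fb heb hey hyv hvb ivy hz hze hzb).
have {}hvb : b < v by clear -nvb hvb; lia.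
apply: (IH (T := downto (b - a) a)); last exact: hbad.
by apply: row_slide => //; clear -ha hyb; lia.
Qed.

Hypothesis IHe : bad_cons e.+1 t -> ~ row_weight_inj e.+1 t.

(** The letter e of t precedes all larger ones, so the bound of the row can be raised past it. *)
Lemma not_row_weight_inj_skip sg s : first_ge e e t -> sg \in zero_one_patterns ->
  occurs t s -> order_iso sg (e.+1.*2 :: map (fun v => v.*2.+1) s) -> ~ row_weight_inj e t.
Proof.
move=> [he _ fbP] hs ho hc; rewrite row_weight_inj_skip; first by apply: IHe; exists sg, s.
move=> v hv; have [hvt|hvt] := boolP (v \in t).
  by have := fbP v hvt; clear -hv; case: eqP; lia.
by rewrite (memNindex hvt) index_mem.
Qed.

Lemma not_row_weight_inj_bad_cons : bad_cons e t -> ~ row_weight_inj e t.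
Proof.
move=> [sg [s [hs ho hc]]].
have [b fb] : exists b, first_ge e b t by apply: first_geP => //; apply: bad_cons_lt => //;
  exists sg, s.
have [hb heb fbP] := fb.
move: hs ho hc; rewrite !inE.
do ![case/orP => [/eqP->|]] => [||||||||||| /eqP->] ho hc.
- open_word s ho hc [|x [|x5 [|x4 [|x3 [|? ?]]]]].
  have [E|N] := eqVneq x b; last by apply: (not_row_weight_inj_head1 fb _ ho _ N hc) => //; nlia.
  subst x; have [E|lt] := eqVneq e b;
    last by apply: (@not_row_weight_inj_large e b t x5 x4) => //; nlia.
  (* Raising the first letter above the letter e of t, which plays 2, turns 12543 into 21543. *)
  subst b; apply: (@not_row_weight_inj_skip [:: 2; 1; 5; 4; 3] _ fb _ ho) => //.
  by rewrite /order_iso /=; conj.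
- open_word s ho hc [|x [|x2 [|x5 [|x4 [|? ?]]]]].
  have [E|N] := eqVneq x b; last by apply: (not_row_weight_inj_head1 fb _ ho _ N hc) => //; nlia.
  (* The letter playing 2 is at least e and less than b, so e < b, and 5 and 4 are decreasing large
     letters. *)
  by subst x; apply: (@not_row_weight_inj_large e b t x5 x4) => //; nlia.
- open_word s ho hc [|x [|x5 [|x2 [|x4 [|? ?]]]]].
  have [E|N] := eqVneq x b; last by apply: (not_row_weight_inj_head1 fb _ ho _ N hc) => //; nlia.
  by subst x; apply: (@not_row_weight_inj_large e b t x5 x4) => //; nlia.
- open_word s ho hc [|x [|x5 [|x4 [|x2 [|? ?]]]]].
  have [E|N] := eqVneq x b; last by apply: (not_row_weight_inj_head1 fb _ ho _ N hc) => //; nlia.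
  by subst x; apply: (@not_row_weight_inj_large e b t x5 x4) => //; nlia.
- open_word s ho hc [|z [|x5 [|x4 [|x3 [|? ?]]]]].
  have A5 : (x5 == b) || (index b t < index x5 t) by apply: fbP => //; nlia.
  have A4 : (x4 == b) || (index b t < index x4 t) by apply: fbP => //; nlia.
  have A3 : (x3 == b) || (index b t < index x3 t) by apply: fbP => //; nlia.
  have N3 : x3 != b by apply/eqP => E; subst x3; nlia.
  (* For b = e the first letter can be raised past e without changing the pattern, because e does
     not play 3. *)
  have [E|lt] := eqVneq e b.
    subst b; apply: (@not_row_weight_inj_skip [:: 2; 1; 5; 4; 3] _ fb _ ho) => //.
    by rewrite /order_iso /=; conj.
  have [zb|zb] := boolP (index z t < index b t);
    last by apply: (not_row_weight_inj_below fb _ ho _ zb hc) => //; nlia.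
  have [h4|h4] := ltnP b x4; first by apply: (@not_row_weight_inj_large e b t x5 x4) => //; nlia.
  apply: (@not_row_weight_inj_small e b t x4 x3 z) => //; try nlia.
  have: x4 != b by apply/eqP => E; subst; nlia.
  by nlia.
- open_word s ho hc [|x [|x5 [|x3 [|x6 [|x4 [|? ?]]]]]].
  have [E|N] := eqVneq x b; last by apply: (not_row_weight_inj_head1 fb _ ho _ N hc) => //; nlia.
  subst x; have [E|lt] := eqVneq e b;
    last by apply: (@not_row_weight_inj_large e b t x5 x4) => //; nlia.
  subst b; apply: (@not_row_weight_inj_skip [:: 2; 1; 5; 3; 6; 4] _ fb _ ho) => //.
  by rewrite /order_iso /=; conj.
- open_word s ho hc [|x [|x5 [|x6 [|x3 [|x4 [|? ?]]]]]].
  have [E|N] := eqVneq x b; last by apply: (not_row_weight_inj_head1 fb _ ho _ N hc) => //; nlia.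
  subst x; have [E|lt] := eqVneq e b;
    last by apply: (@not_row_weight_inj_large e b t x5 x4) => //; nlia.
  subst b; apply: (@not_row_weight_inj_skip [:: 2; 1; 5; 6; 3; 4] _ fb _ ho) => //.
  by rewrite /order_iso /=; conj.
- open_word s ho hc [|z [|x5 [|x3 [|x6 [|x4 [|? ?]]]]]].
  have A5 : (x5 == b) || (index b t < index x5 t) by apply: fbP => //; nlia.
  have A4 : (x4 == b) || (index b t < index x4 t) by apply: fbP => //; nlia.
  have A3 : (x3 == b) || (index b t < index x3 t) by apply: fbP => //; nlia.
  have N3 : x3 != b by apply/eqP => E; subst x3; nlia.
  have [E|lt] := eqVneq e b.
    subst b; apply: (@not_row_weight_inj_skip [:: 2; 1; 5; 3; 6; 4] _ fb _ ho) => //.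
    by rewrite /order_iso /=; conj.
  have [zb|zb] := boolP (index z t < index b t);
    last by apply: (not_row_weight_inj_below fb _ ho _ zb hc) => //; nlia.
  (* Slid down to x4, the letter b lies just below the raised x4, so z, b, x3, x6, x4 form 13254. *)
  apply: (@not_row_weight_inj_231 b z x5 x4 x6 fb _ _ _ zb _ _ _ _ _ _ _ _ _ x4) => //; try nlia.
  move=> h4 h6 bx; have ha : e <= x4 <= b by nlia.
  apply: (@bad_occurs _ [:: 1; 3; 2; 5; 4] (map (act_row (downto (b - x4) x4)) [:: z; b; x3; x6;
    x4])) => //.
    by rewrite occurs_app_row /occurs /=; conj.
  rewrite /order_iso /= (slide_b ha) (slide_low ha (v := z)) ?(slide_low ha (v := x3))
    ?(slide_high ha (v := x6)) ?(slide_mid ha (v := x4)); conj.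
- open_word s ho hc [|z [|x5 [|x6 [|x3 [|x4 [|? ?]]]]]].
  have A5 : (x5 == b) || (index b t < index x5 t) by apply: fbP => //; nlia.
  have A4 : (x4 == b) || (index b t < index x4 t) by apply: fbP => //; nlia.
  have A3 : (x3 == b) || (index b t < index x3 t) by apply: fbP => //; nlia.
  have N3 : x3 != b by apply/eqP => E; subst x3; nlia.
  have [E|lt] := eqVneq e b.
    subst b; apply: (@not_row_weight_inj_skip [:: 2; 1; 5; 6; 3; 4] _ fb _ ho) => //.
    by rewrite /order_iso /=; conj.
  have [zb|zb] := boolP (index z t < index b t);
    last by apply: (not_row_weight_inj_below fb _ ho _ zb hc) => //; nlia.
  apply: (@not_row_weight_inj_231 b z x5 x4 x6 fb _ _ _ zb _ _ _ _ _ _ _ _ _ x4) => //; try nlia.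
  move=> h4 h6 bx; have ha : e <= x4 <= b by nlia.
  apply: (@bad_occurs _ [:: 1; 3; 5; 2; 4] (map (act_row (downto (b - x4) x4)) [:: z; b; x6; x3;
    x4])) => //.
    by rewrite occurs_app_row /occurs /=; conj.
  rewrite /order_iso /= (slide_b ha) (slide_low ha (v := z)) ?(slide_low ha (v := x3))
    ?(slide_high ha (v := x6)) ?(slide_mid ha (v := x4)); conj.
- open_word s ho hc [|z [|x5 [|y [|x6 [|x4 [|? ?]]]]]].
  have A5 : (x5 == b) || (index b t < index x5 t) by apply: fbP => //; nlia.
  have A4 : (x4 == b) || (index b t < index x4 t) by apply: fbP => //; nlia.
  have N4 : x4 != b by apply/eqP => E; subst x4; nlia.
  have [E|lt] := eqVneq e b.
    subst b; apply: (@not_row_weight_inj_skip [:: 3; 1; 5; 2; 6; 4] _ fb _ ho) => //.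
    by rewrite /order_iso /=; conj.
  have [zb|zb] := boolP (index z t < index b t);
    last by apply: (not_row_weight_inj_below fb _ ho _ zb hc) => //; nlia.
  (* Here y < e plays 2, so b slides down to e, above y and below x4, and z, b, y, x6, x4 form
     13254. *)
  apply: (@not_row_weight_inj_231 b z x5 x4 x6 fb _ _ _ zb _ _ _ _ _ _ _ _ _ e) => //; try nlia.
  move=> h4 h6 bx; have ha : e <= e <= b by nlia.
  apply: (@bad_occurs _ [:: 1; 3; 2; 5; 4] (map (act_row (downto (b - e) e)) [:: z; b; y; x6;
    x4])) => //.
    by rewrite occurs_app_row /occurs /=; conj.
  rewrite /order_iso /= (slide_b ha) (slide_low ha (v := z)) ?(slide_low ha (v := y))
    ?(slide_high ha (v := x6)) ?(slide_mid ha (v := x4)); conj.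
- open_word s ho hc [|z [|x5 [|x6 [|y [|x4 [|? ?]]]]]].
  have A5 : (x5 == b) || (index b t < index x5 t) by apply: fbP => //; nlia.
  have A4 : (x4 == b) || (index b t < index x4 t) by apply: fbP => //; nlia.
  have N4 : x4 != b by apply/eqP => E; subst x4; nlia.
  have [E|lt] := eqVneq e b.
    subst b; apply: (@not_row_weight_inj_skip [:: 3; 1; 5; 6; 2; 4] _ fb _ ho) => //.
    by rewrite /order_iso /=; conj.
  have [zb|zb] := boolP (index z t < index b t);
    last by apply: (not_row_weight_inj_below fb _ ho _ zb hc) => //; nlia.
  apply: (@not_row_weight_inj_231 b z x5 x4 x6 fb _ _ _ zb _ _ _ _ _ _ _ _ _ e) => //; try nlia.
  move=> h4 h6 bx; have ha : e <= e <= b by nlia.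
  apply: (@bad_occurs _ [:: 1; 3; 5; 2; 4] (map (act_row (downto (b - e) e)) [:: z; b; x6; y;
    x4])) => //.
    by rewrite occurs_app_row /occurs /=; conj.
  rewrite /order_iso /= (slide_b ha) (slide_low ha (v := z)) ?(slide_low ha (v := y))
    ?(slide_high ha (v := x6)) ?(slide_mid ha (v := x4)); conj.
- open_word s ho hc [|z [|x5 [|x6 [|x4 [|y [|? ?]]]]]].
  have A5 : (x5 == b) || (index b t < index x5 t) by apply: fbP => //; nlia.
  have A4 : (x4 == b) || (index b t < index x4 t) by apply: fbP => //; nlia.
  have N4 : x4 != b by apply/eqP => E; subst x4; nlia.
  have [E|lt] := eqVneq e b.
    subst b; apply: (@not_row_weight_inj_skip [:: 3; 1; 5; 6; 4; 2] _ fb _ ho) => //.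
    by rewrite /order_iso /=; conj.
  have [zb|zb] := boolP (index z t < index b t);
    last by apply: (not_row_weight_inj_below fb _ ho _ zb hc) => //; nlia.
  apply: (@not_row_weight_inj_231 b z x5 x4 x6 fb _ _ _ zb _ _ _ _ _ _ _ _ _ e) => //; try nlia.
  move=> h4 h6 bx; have ha : e <= e <= b by nlia.
  apply: (@bad_occurs _ [:: 1; 3; 5; 4; 2] (map (act_row (downto (b - e) e)) [:: z; b; x6; x4;
    y])) => //.
    by rewrite occurs_app_row /occurs /=; conj.
  rewrite /order_iso /= (slide_b ha) (slide_low ha (v := z)) ?(slide_low ha (v := y))
    ?(slide_high ha (v := x6)) ?(slide_mid ha (v := x4)); conj.
Qed.
End BadStep.

(** * Permutations avoiding the patterns *)

Section GoodStep.
Variables (e : nat) (t : seq nat).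
Hypothesis w : std_word t.
Hypothesis NB : ~ bad t.
Hypothesis NE : ~ bad_cons e t.

Lemma avoid sg s : sg \in zero_one_patterns -> occurs t s -> order_iso sg s -> False.
Proof. by move=> h1 h2 h3; apply: NB; exists sg, s. Qed.

Lemma avoidE sg s : sg \in zero_one_patterns -> occurs t s ->
  order_iso sg (e.*2 :: map (fun v => v.*2.+1) s) -> False.
Proof. by move=> h1 h2 h3; apply: NE; exists sg, s. Qed.

Ltac occs := rewrite /occurs /=; conj.
Ltac chains := rewrite /order_iso /=; conj.
Ltac wit := first [by occs | by chains].

Variable b : nat.
Hypothesis fb : first_ge e b t.

Lemma first_above v : v \in t -> e <= v -> v != b -> index b t < index v t.
Proof. by case: fb => _ _ h hv hev nv; move: (h v hv hev); rewrite (negbTE nv). Qed.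

(** The letter b.-1 is small and stands after b. With e, b, b.-1, x, y in the roles 1, 3, 2, 5, 4,
    its place relative to x and y yields 13254, 13524 or 13542. *)
Lemma larges_increase x y : e < b -> b < y -> y < x -> x \in t -> ~~ (index x t < index y t).
Proof.
move=> heb hby hyx hx; apply/negP => hi.
have hxs : x < size t by rewrite -std_word_mem.
have [hb _ _] := fb.
have hy : y \in t by rewrite std_word_mem //; nlia.
have hu : b.-1 \in t by rewrite std_word_mem //; nlia.
have bu : index b t < index b.-1 t by apply: first_above => //; nlia.
have bx : index b t < index x t by apply: first_above => //; nlia.
have nux : index b.-1 t <> index x t by move/(index_inj hu); nlia.
have nuy : index b.-1 t <> index y t by move/(index_inj hu); nlia.
have [h|h] := ltnP (index b.-1 t) (index x t).
  by apply: (@avoidE [:: 1; 3; 2; 5; 4] [:: b; b.-1; x; y]) => //; wit.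
have [h'|h'] := ltnP (index b.-1 t) (index y t).
  by apply: (@avoidE [:: 1; 3; 5; 2; 4] [:: b; x; b.-1; y]) => //; wit.
by apply: (@avoidE [:: 1; 3; 5; 4; 2] [:: b; x; y; b.-1]) => //; wit.
Qed.

Lemma no_invv_large j : e < b -> b <= j -> ~~ invv j t.
Proof.
move=> heb hj; apply/negP => hi; have hj1 := invv_mem hi.
have [E|N] := eqVneq j b.
  subst j; move: hi; rewrite /invv => hi.
  have : index b t < index b.+1 t by apply: first_above => //; nlia.
  by nlia.
have := @larges_increase j.+1 j heb; rewrite hj1; move: hi; rewrite /invv => -> H.
by move: (H ltac:(nlia) ltac:(nlia) erefl).
Qed.

(** A descent would give 21543 with e, z, b, x, y. *)
Lemma smalls_increase z x y : z \in t -> z < e -> index z t < index b t ->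
  e <= y -> y < x -> x < b -> ~~ (index x t < index y t).
Proof.
move=> hz hze hzb hey hyx hxb; apply/negP => hi; have [hb _ _] := fb.
have hbs : b < size t by rewrite -std_word_mem.
have hx : x \in t by rewrite std_word_mem //; nlia.
have hy : y \in t by rewrite std_word_mem //; nlia.
have bx : index b t < index x t by apply: first_above => //; nlia.
by apply: (@avoidE [:: 2; 1; 5; 4; 3] [:: z; b; x; y]) => //; wit.
Qed.

(** Lowering the first letter past e preserves an occurrence without e. Otherwise e plays the value
    just below that of the first letter. There is none if the pattern starts with 1; if it starts
    with 2, exchanging 1 and 2 gives another pattern; if it starts with 3, then 2 stands after 5,
    but e precedes all larger letters. *)
Lemma skip_avoid : b = e -> ~ bad_cons e.+1 t.
Proof.
move=> E; have FA := first_above; subst b; move=> [sg [s [hs ho hc]]].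
have [hin|hni] := boolP (e \in s); last first.
  apply: (avoidE hs ho).
  pose f v := if v == e.+1.*2 then e.*2 else v.
  have -> : e.*2 :: [seq v.*2.+1 | v <- s] = map f (e.+1.*2 :: [seq v.*2.+1 | v <- s]).
    rewrite /= {1}/f eqxx -map_comp; congr cons.
    by apply: eq_map => v /=; rewrite /f; case: ifP => //; lia.
  apply: order_iso_map hc => // u v; rewrite !inE.
  have ns x : x \in s -> x != e by apply: contraTneq => ->.
  by move=> /orP[/eqP->|/mapP[x /ns hx ->]] /orP[/eqP->|/mapP[y /ns hy ->]];
     rewrite /f; do !case: ifP; clear -hx hy || clear -hx || clear -hy || clear; lia.
move: hs ho hc hin; rewrite !inE.
do ![case/orP => [/eqP->|]] => [||||||||||| /eqP->] ho hc.
1-4: by open_word s ho hc [|x1 [|x2 [|x3 [|x4 [|? ?]]]]]; rewrite !inE; nlia.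
2,3: by open_word s ho hc [|x1 [|x2 [|x3 [|x4 [|x5 [|? ?]]]]]]; rewrite !inE; nlia.
- open_word s ho hc [|x1 [|x2 [|x3 [|x4 [|? ?]]]]]; rewrite !inE => h.
  have E : x1 = e by nlia.
  by subst x1; apply: (@avoidE [:: 1; 2; 5; 4; 3] [:: e; x2; x3; x4]) => //; wit.
- open_word s ho hc [|x1 [|x2 [|x3 [|x4 [|x5 [|? ?]]]]]]; rewrite !inE => h.
  have E : x1 = e by nlia.
  by subst x1; apply: (@avoidE [:: 1; 2; 5; 3; 6; 4] [:: e; x2; x3; x4; x5]) => //; wit.
- open_word s ho hc [|x1 [|x2 [|x3 [|x4 [|x5 [|? ?]]]]]]; rewrite !inE => h.
  have E : x1 = e by nlia.
  by subst x1; apply: (@avoidE [:: 1; 2; 5; 6; 3; 4] [:: e; x2; x3; x4; x5]) => //; wit.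
- open_word s ho hc [|x1 [|x2 [|x3 [|x4 [|x5 [|? ?]]]]]]; rewrite !inE => h.
  have E : x3 = e by nlia.
  by subst x3; have : index e t < index x2 t; [apply: FA => //; nlia | nlia].
- open_word s ho hc [|x1 [|x2 [|x3 [|x4 [|x5 [|? ?]]]]]]; rewrite !inE => h.
  have E : x4 = e by nlia.
  by subst x4; have : index e t < index x2 t; [apply: FA => //; nlia | nlia].
open_word s ho hc [|x1 [|x2 [|x3 [|x4 [|x5 [|? ?]]]]]]; rewrite !inE => h.
have E : x5 = e by nlia.
by subst x5; have : index e t < index x2 t; [apply: FA => //; nlia | nlia].
Qed.

(* Marks the membership hypotheses that [norm] has already used. *)
Definition seen (P : Prop) := P.

Lemma map_preim (f : nat -> nat) (s' l : seq nat) :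
  all (mem (map f l)) s' -> exists s, s' = map f s.
Proof.
elim: s' => [|v s' IHs] /=; first by exists [::].
by case/andP => /mapP[u _ ->] /IHs[s ->]; exists (u :: s).
Qed.

(** The slide preserves the order of the letters other than b; h inverts it on s. *)
Lemma slide_order_iso a sg s : e <= a <= b -> sg \in zero_one_patterns -> b \notin s ->
  order_iso sg (map (act_row (downto (b - a) a)) s) -> order_iso sg s.
Proof.
move=> ha hs hb hc; pose h v := nth 0 s (index v (map (act_row (downto (b - a) a)) s)).
have hK x : x \in s -> h (act_row (downto (b - a) a) x) = x.
  by move=> hx; rewrite /h index_map ?nth_index //; apply: act_row_inj.
have -> : s = map h (map (act_row (downto (b - a) a)) s).
  by rewrite -map_comp -[LHS]map_id; apply/eq_in_map => x hx /=; rewrite hK.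
have ns x : x \in s -> x != b by apply: contraTneq => ->.
apply: order_iso_map hc => // _ _ /mapP[x hx ->] /mapP[y hy ->].
by rewrite !hK // (slide_lt ha) ?ns.
Qed.

(** Fixes the role of b in the pattern. Every other letter is then below e or stands after b, and
    inequalities between slid letters are translated back to the letters of t. *)
Ltac norm g g0 g1 g2 g3 FA :=
  rewrite !inE; do ?[case/orP]; move=> /eqP E;
  match goal with E : _ = ?x |- _ => subst x end;
  repeat match goal with
  | Hx : is_true (b \in t) |- _ => change (seen (b \in t)) in Hx
  | Hx : is_true (?x \in t) |- _ =>
     let N := fresh "N" in let F := fresh "F" in
     (have N : x != b by apply/eqP => ?; subst x; nlia);
     have F := FA x Hx N;
     change (seen (x \in t)) in Hx
  end;
  repeat match goal with
  | H : is_true (g b < g ?v) |- _ => rewrite g0 in H; move/g2: H => H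
  | H : is_true (g ?u < g b) |- _ => rewrite g0 in H; move/g1: H => H
  | H : is_true (g ?u < g ?v) |- _ => move/(g3 u v ltac:(assumption) ltac:(assumption)): H => H
  end; try nlia; unfold seen in *.

(** Case analysis on the role of b after the slide. As first letter of the pattern, b can be
    replaced by e, possibly in another pattern. As 5 or 6 it keeps its role at its original height,
    except that a 6 below b yields 12543 or 21543. In the other roles either a pattern starting with
    e appears or some small or large letters decrease. *)
Lemma slide_avoid (z a : nat) : z \in t -> z < e -> index z t < index b t -> e <= a -> a < b ->
  ~ bad (app_row (downto (b - a) a) t).
Proof.
move=> hz hze hzb hea hab [sg [s' [hs ho hc]]].
have heb : e < b by nlia.
have ha : e <= a <= b by rewrite hea ltnW.
have [hb _ _] := fb.
have [s es] : exists s : seq nat, s' = map (act_row (downto (b - a) a)) s.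
  by move: ho; rewrite /occurs app_rowE => /andP[/map_preim[s ->] _]; exists s.
subst s'; rewrite occurs_app_row in ho.
have [hin|hni] := boolP (b \in s); last by apply: (avoid hs ho); apply: slide_order_iso hc.
set g : nat -> nat := act_row (downto (b - a) a) in hc *.
have g0 : g b = a := slide_b ha.
have g1 (v : nat) : g v < a -> v < a by move/(@slide_ltb _ _ _ ha v)/andP => [].
have g2 (v : nat) : a < g v -> a <= v by move/(@slide_gtb _ _ _ ha v)/andP => [].
have g3 (u v : nat) : u != b -> v != b -> g u < g v -> u < v.
  by move=> h1 h2; rewrite /g (slide_lt ha).
have FA (v : nat) : v \in t -> v != b -> (v < e) || (index b t < index v t).
  by move=> hv nv; case: (ltnP v e) => //= h; apply: first_above.
have LI x y : b < y -> y < x -> x \in t -> index x t < index y t -> False.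
  by move=> h1 h2 h3; apply/negP; apply: larges_increase.
have SI x y : e <= y -> y < x -> x < b -> index x t < index y t -> False.
  by move=> h1 h2 h3; apply/negP; apply: (smalls_increase hz).
clearbody g.
(* A decreasing pair from a on, apart from b, straddles b, since both the large and the small
   letters increase. *)
have key (x y : nat) : x \in t -> y \in t -> a <= y -> y < x -> x != b -> y != b ->
    index x t < index y t -> y < b < x.
  move=> hx hy h1 h2 h3 h4 h5; apply/andP; split.
    by rewrite ltnNge; apply/negP => h6; apply: (LI x y) => //; nlia.
  by rewrite ltnNge; apply/negP => h6; apply: (SI x y) => //; nlia.
move: hs ho hc hin; rewrite !inE.
do ![case/orP => [/eqP->|]] => [||||||||||| /eqP->] ho hc.
- open_word s ho hc [|x1 [|x2 [|x3 [|x4 [|x5 [|? ?]]]]]]; norm g g0 g1 g2 g3 FA.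
  + by apply: (@avoidE [:: 1; 2; 5; 4; 3] [:: x2; x3; x4; x5]) => //; wit.
  + have k1 : x4 < b < x3 by apply: key => //; nlia.
    have k2 : x5 < b < x4 by apply: key => //; nlia.
    by nlia.
  + by apply: (@avoid [:: 1; 2; 5; 4; 3] [:: x1; x2; b; x4; x5]) => //; wit.
- open_word s ho hc [|x1 [|x2 [|x3 [|x4 [|x5 [|? ?]]]]]]; norm g g0 g1 g2 g3 FA.
  + by apply: (@avoidE [:: 1; 3; 2; 5; 4] [:: x2; x3; x4; x5]) => //; wit.
  + have k1 : x5 < b < x4 by apply: key => //; nlia.
    (* At its original height b plays 5, as x5 < b < x4, and e plays 3 or 2 according to the side of
       x3. *)
    have [h|h] := ltnP x3 e.
      by apply: (@avoidE [:: 3; 1; 5; 2; 6; 4] [:: x1; b; x3; x4; x5]) => //; wit.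
    by apply: (@avoidE [:: 2; 1; 5; 3; 6; 4] [:: x1; b; x3; x4; x5]) => //; wit.
  + by apply: (@avoid [:: 1; 3; 2; 5; 4] [:: x1; x2; x3; b; x5]) => //; wit.
- open_word s ho hc [|x1 [|x2 [|x3 [|x4 [|x5 [|? ?]]]]]]; norm g g0 g1 g2 g3 FA.
  + by apply: (@avoidE [:: 1; 3; 5; 2; 4] [:: x2; x3; x4; x5]) => //; wit.
  + have k1 : x5 < b < x3 by apply: key => //; nlia.
    have [h|h] := ltnP x4 e.
      by apply: (@avoidE [:: 3; 1; 5; 6; 2; 4] [:: x1; b; x3; x4; x5]) => //; wit.
    by apply: (@avoidE [:: 2; 1; 5; 6; 3; 4] [:: x1; b; x3; x4; x5]) => //; wit.
  + by apply: (@avoid [:: 1; 3; 5; 2; 4] [:: x1; x2; b; x4; x5]) => //; wit.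
- open_word s ho hc [|x1 [|x2 [|x3 [|x4 [|x5 [|? ?]]]]]]; norm g g0 g1 g2 g3 FA.
  + by apply: (@avoidE [:: 1; 3; 5; 4; 2] [:: x2; x3; x4; x5]) => //; wit.
  + have k1 : x4 < b < x3 by apply: key => //; nlia.
    have [h|h] := ltnP x5 e.
      by apply: (@avoidE [:: 3; 1; 5; 6; 4; 2] [:: x1; b; x3; x4; x5]) => //; wit.
    by apply: (SI x4 x5) => //; nlia.
  + by apply: (@avoid [:: 1; 3; 5; 4; 2] [:: x1; x2; b; x4; x5]) => //; wit.
- open_word s ho hc [|x1 [|x2 [|x3 [|x4 [|x5 [|? ?]]]]]]; norm g g0 g1 g2 g3 FA.
  + have [h|h] := ltnP x2 e.
      by apply: (@avoidE [:: 2; 1; 5; 4; 3] [:: x2; x3; x4; x5]) => //; wit.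
    by apply: (@avoidE [:: 1; 2; 5; 4; 3] [:: x2; x3; x4; x5]) => //; wit.
  + by apply: (@avoid [:: 2; 1; 5; 4; 3] [:: x1; x2; b; x4; x5]) => //; wit.
- open_word s ho hc [|x1 [|x2 [|x3 [|x4 [|x5 [|x6 [|? ?]]]]]]]; norm g g0 g1 g2 g3 FA.
  + by apply: (@avoidE [:: 1; 2; 5; 3; 6; 4] [:: x2; x3; x4; x5; x6]) => //; wit.
  + have k1 : x4 < b < x3 by apply: key => //; nlia.
    have k2 : x6 < b < x5 by apply: key => //; nlia.
    by apply: (@avoidE [:: 2; 1; 5; 3; 6; 4] [:: x1; b; x4; x5; x6]) => //; wit.
  + have [h|h] := ltnP b x5.
      by apply: (@avoid [:: 1; 2; 5; 3; 6; 4] [:: x1; x2; b; x4; x5; x6]) => //; wit.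
    by apply: (@avoid [:: 1; 2; 5; 4; 3] [:: x1; x2; b; x5; x6]) => //; wit.
  + by apply: (@avoid [:: 1; 2; 5; 3; 6; 4] [:: x1; x2; x3; x4; b; x6]) => //; wit.
- open_word s ho hc [|x1 [|x2 [|x3 [|x4 [|x5 [|x6 [|? ?]]]]]]]; norm g g0 g1 g2 g3 FA.
  + by apply: (@avoidE [:: 1; 2; 5; 6; 3; 4] [:: x2; x3; x4; x5; x6]) => //; wit.
  + have k1 : x5 < b < x3 by apply: key => //; nlia.
    have k2 : x6 < b < x4 by apply: key => //; nlia.
    by apply: (@avoidE [:: 2; 1; 5; 6; 3; 4] [:: x1; b; x4; x5; x6]) => //; wit.
  + have [h|h] := ltnP b x4.
      by apply: (@avoid [:: 1; 2; 5; 6; 3; 4] [:: x1; x2; b; x4; x5; x6]) => //; wit.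
    by apply: (@avoid [:: 1; 2; 5; 4; 3] [:: x1; x2; b; x4; x5]) => //; wit.
  + by apply: (@avoid [:: 1; 2; 5; 6; 3; 4] [:: x1; x2; x3; b; x5; x6]) => //; wit.
- open_word s ho hc [|x1 [|x2 [|x3 [|x4 [|x5 [|x6 [|? ?]]]]]]]; norm g g0 g1 g2 g3 FA.
  + have [h|h] := ltnP x2 e.
      by apply: (@avoidE [:: 2; 1; 5; 3; 6; 4] [:: x2; x3; x4; x5; x6]) => //; wit.
    by apply: (@avoidE [:: 1; 2; 5; 3; 6; 4] [:: x2; x3; x4; x5; x6]) => //; wit.
  + have [h|h] := ltnP b x5.
      by apply: (@avoid [:: 2; 1; 5; 3; 6; 4] [:: x1; x2; b; x4; x5; x6]) => //; wit.
    by apply: (@avoid [:: 2; 1; 5; 4; 3] [:: x1; x2; b; x5; x6]) => //; wit.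
  + by apply: (@avoid [:: 2; 1; 5; 3; 6; 4] [:: x1; x2; x3; x4; b; x6]) => //; wit.
- open_word s ho hc [|x1 [|x2 [|x3 [|x4 [|x5 [|x6 [|? ?]]]]]]]; norm g g0 g1 g2 g3 FA.
  + have [h|h] := ltnP x2 e.
      by apply: (@avoidE [:: 2; 1; 5; 6; 3; 4] [:: x2; x3; x4; x5; x6]) => //; wit.
    by apply: (@avoidE [:: 1; 2; 5; 6; 3; 4] [:: x2; x3; x4; x5; x6]) => //; wit.
  + have [h|h] := ltnP b x4.
      by apply: (@avoid [:: 2; 1; 5; 6; 3; 4] [:: x1; x2; b; x4; x5; x6]) => //; wit.
    by apply: (@avoid [:: 2; 1; 5; 4; 3] [:: x1; x2; b; x4; x5]) => //; wit.
  + by apply: (@avoid [:: 2; 1; 5; 6; 3; 4] [:: x1; x2; x3; b; x5; x6]) => //; wit.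
- open_word s ho hc [|x1 [|x2 [|x3 [|x4 [|x5 [|x6 [|? ?]]]]]]]; norm g g0 g1 g2 g3 FA.
  + have [h|h] := ltnP x4 e.
      by apply: (@avoidE [:: 3; 1; 5; 2; 6; 4] [:: x2; x3; x4; x5; x6]) => //; wit.
    have [h'|h'] := ltnP x2 e.
      by apply: (@avoidE [:: 2; 1; 5; 3; 6; 4] [:: x2; x3; x4; x5; x6]) => //; wit.
    by apply: (@avoidE [:: 1; 2; 5; 3; 6; 4] [:: x2; x3; x4; x5; x6]) => //; wit.
  + have [h|h] := ltnP b x5.
      by apply: (@avoid [:: 3; 1; 5; 2; 6; 4] [:: x1; x2; b; x4; x5; x6]) => //; wit.
    by apply: (@avoid [:: 2; 1; 5; 4; 3] [:: x1; x2; b; x5; x6]) => //; wit.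
  + by apply: (@avoid [:: 3; 1; 5; 2; 6; 4] [:: x1; x2; x3; x4; b; x6]) => //; wit.
- open_word s ho hc [|x1 [|x2 [|x3 [|x4 [|x5 [|x6 [|? ?]]]]]]]; norm g g0 g1 g2 g3 FA.
  + have [h|h] := ltnP x5 e.
      by apply: (@avoidE [:: 3; 1; 5; 6; 2; 4] [:: x2; x3; x4; x5; x6]) => //; wit.
    have [h'|h'] := ltnP x2 e.
      by apply: (@avoidE [:: 2; 1; 5; 6; 3; 4] [:: x2; x3; x4; x5; x6]) => //; wit.
    by apply: (@avoidE [:: 1; 2; 5; 6; 3; 4] [:: x2; x3; x4; x5; x6]) => //; wit.
  + have [h|h] := ltnP b x4.
      by apply: (@avoid [:: 3; 1; 5; 6; 2; 4] [:: x1; x2; b; x4; x5; x6]) => //; wit.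
    by apply: (@avoid [:: 2; 1; 5; 4; 3] [:: x1; x2; b; x4; x6]) => //; wit.
  + by apply: (@avoid [:: 3; 1; 5; 6; 2; 4] [:: x1; x2; x3; b; x5; x6]) => //; wit.
- open_word s ho hc [|x1 [|x2 [|x3 [|x4 [|x5 [|x6 [|? ?]]]]]]]; norm g g0 g1 g2 g3 FA.
  + have [h|h] := ltnP x6 e.
      by apply: (@avoidE [:: 3; 1; 5; 6; 4; 2] [:: x2; x3; x4; x5; x6]) => //; wit.
    have [h'|h'] := ltnP x2 e.
      by apply: (@avoidE [:: 2; 1; 5; 4; 3] [:: x2; x4; x5; x6]) => //; wit.
    by apply: (@avoidE [:: 1; 2; 5; 4; 3] [:: x2; x4; x5; x6]) => //; wit.
  + have [h|h] := ltnP b x4.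
      by apply: (@avoid [:: 3; 1; 5; 6; 4; 2] [:: x1; x2; b; x4; x5; x6]) => //; wit.
    by apply: (@avoid [:: 2; 1; 5; 4; 3] [:: x1; x2; b; x4; x5]) => //; wit.
  + by apply: (@avoid [:: 3; 1; 5; 6; 4; 2] [:: x1; x2; x3; b; x5; x6]) => //; wit.
Qed.
End GoodStep.

Lemma row_top e T t : std_word t -> size t <= e -> is_row e T t -> T = [::].
Proof.
move=> w he; case: T => // j T; rewrite row_cons => /and4P[hj /invv_mem].
by rewrite std_word_mem //; lia.
Qed.

Lemma mem_downto k a : a \in downto k.+1 a.
Proof. by elim: k => [|k IH]; rewrite [downto _ _]/= inE ?addn0 ?eqxx // IH orbT. Qed.

(** Inserting a letter at or above e changes the side of e for no other letter. *)
Lemma bad_cons_insert e b t : e <= b -> bad_cons e t -> bad_cons e (cons_std b t).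
Proof.
move=> heb [sg [s [hs ho hc]]]; exists sg, (map (bumpv b) s); split; rewrite ?occurs_cons_std //.
pose f v := if v == e.*2 then e.*2 else (bumpv b v./2).*2.+1.
have -> : e.*2 :: [seq v.*2.+1 | v <- map (bumpv b) s] = map f (e.*2 :: [seq v.*2.+1 | v <- s]).
  rewrite /= {1}/f eqxx -!map_comp; congr cons.
  by apply: eq_map => v /=; rewrite /f /= uphalf_double; case: ifP => //; lia.
apply: order_iso_map hc => // u v; rewrite !inE.
by move=> /orP[/eqP->|/mapP[x _ ->]] /orP[/eqP->|/mapP[y _ ->]];
  rewrite /f /bumpv /= ?uphalf_double; do !case: ifP; lia.
Qed.

Lemma row_weight_inj_good e t : std_word t -> e <= size t -> ~ bad t -> ~ bad_cons e t ->
  (forall v, std_word v -> size v = size t -> ~ bad v -> weight_inj v) ->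
  (e < size t -> ~ bad_cons e.+1 t -> row_weight_inj e.+1 t) ->
  (forall t0, std_word t0 -> (size t0).+1 = size t -> e <= size t0 -> ~ bad t0 ->
    ~ bad_cons e t0 -> row_weight_inj e t0) ->
  row_weight_inj e t.
Proof.
move=> w he NB NE IHc IHe IHb.
have [hlt|hge] := ltnP e (size t); last first.
  move=> T D T' D' /(row_top w hge)-> p /(row_top w hge)-> p' _ hw; split=> //.
  exact: (IHc t).
have [b fb] := first_geP w hlt; have [hb heb fbP] := fb.
have [E|N] := eqVneq b e.
  rewrite row_weight_inj_skip; first by apply: IHe => //; apply: (skip_avoid w NE fb E).
  move=> v hv; rewrite -E; have [hvt|hvt] := boolP (v \in t).
    by apply: (first_above fb) => //; lia.
  by rewrite (memNindex hvt) index_mem.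
have {}heb : e < b by lia.
have hbs : b < size t by rewrite -std_word_mem.
(* If b is the first letter of t, it follows e immediately and can be removed. *)
have [Ib|Ib] := eqVneq (index b t) 0.
  have [t0 [w0 s0 et]] : exists t0, [/\ std_word t0, (size t0).+1 = size t & t = cons_std b t0].
    case: t w hb Ib {he hlt hbs NB NE IHc IHe IHb fb fbP} => // x t1 w hb Ib.
    have xb : x = b by move: Ib; rewrite /=; case: eqP.
    by have [_ h1 h2] := std_word_cons w; exists (unbumps x t1); rewrite size_map -xb.
  subst t; apply: row_weight_inj_insert; first lia.
    by move=> j hj; apply: (no_invv_large w NE fb).
  apply: IHb => //; [lia | |].
    by move=> h; apply: NB; apply/bad_cons_std; left.
  by move=> h; apply: NE; apply: bad_cons_insert h; lia.
(* Otherwise the first letter z of t is below e and stands before b, so the small letters increase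
   and every first row is a slide of b. *)
pose z := nth 0 t 0.
have hs : 0 < size t by lia.
have hz : z \in t by rewrite mem_nth.
have Iz : index z t = 0 by rewrite index_uniq ?std_word_uniq.
have hzb : index z t < index b t by rewrite Iz lt0n.
have hze : z < e.
  rewrite ltnNge; apply/negP => h.
  have : index b t < index z t by apply: (first_above fb) => //; apply: contra Ib => /eqP<-;
    rewrite Iz.
  by rewrite Iz.
have rowE T : is_row e T t -> exists2 a, a + size T = b & T = downto (size T) a.
  move=> hr; apply: row_downto_uniq (hr) _.
    case: T hr => // j T; rewrite row_cons => /and4P[_ h1 h2 _].
    have hj : j < b by rewrite ltnNge; apply: contraL h1; apply: (no_invv_large w NE fb).
    by rewrite /= hj; apply: sub_all h2 => i /=; lia.
  by move=> j h1 h2; rewrite /invv; apply: (smalls_increase w NE fb hz).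
move=> T D T' D' r p r' p' hs' hw.
have [a a1 a2] := rowE T r; have [a' a1' a2'] := rowE T' r'.
have ET : T = T' by rewrite a2 a2' -hs'; congr downto; lia.
subst T'; split=> //; apply: (IHc (app_row T t)) => //.
- by apply: std_word_app_row => //; case/and3P: r.
- by rewrite size_app_row.
case: T r a1 a2 {p r' p' hw hs' a1' a2'} => // j T r a1 a2.
have hsz : size (j :: T) = b - a by lia.
have hea : e <= a.
  case/and3P: r => _ /allP /(_ a) + _; apply.
  by rewrite a2 /= mem_downto.
rewrite a2 hsz; apply: (slide_avoid w NB NE fb hz hze hzb hea).
by move: a1 => /=; lia.
Qed.

Theorem weight_inj_bad w : std_word w -> (bad w -> ~ weight_inj w) /\ (~ bad w -> weight_inj w).
Proof.
move: {2}(size w) (leqnn (size w)) => n; elim: n w => [|n IH] w.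
  case: w => // _ _; split=> [[sg [s [hs /andP[ha _] hc]]]|_ [|? ?] [|? ?] //].
  case: s ha hc => // _; move: hs; rewrite !inE.
  by do ![case/orP => [/eqP->|]] => [||||||||||| /eqP->].
case: w => [|e t] hn ww; first exact: (IH [::]).
have [+ + ->] := std_word_cons ww; set t' := unbumps e t => he w.
have st : size t' <= n by rewrite size_map.
rewrite weight_inj_cons_std bad_cons_std.
(* Inner induction on the distance k from the bound e' to the size of t'; at k = 0 only the empty
   row is left. *)
suff H k e' : e' + k = size t' ->
    (bad_cons e' t' -> ~ row_weight_inj e' t') /\ (~ bad t' -> ~ bad_cons e' t' ->
      row_weight_inj e' t').
  have [h1 h2] := H (size t' - e) e ltac:(rewrite size_map in st *; lia).
  split=> [[hb|//]|hb]; last by apply: h2 => h; apply: hb; [left|right].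
  move=> hz; have [+ _] := IH t' st w; move=> /(_ hb); apply.
  exact: (@row_weight_inj_child e [::]).
have child e0 T : is_row e0 T t' -> bad (app_row T t') -> ~ row_weight_inj e0 t'.
  move=> hr hb hz; have [h _] := IH (app_row T t') ltac:(by rewrite size_app_row) ltac:(by apply:
    std_word_app_row => //; case/and3P: hr).
  by apply: (h hb); apply: row_weight_inj_child hz.
elim: k e' => [|k IHk] e' hk.
  split=> [/(bad_cons_lt w)|NB NE]; first lia.
  apply: row_weight_inj_good => //; first lia.
  - by move=> v wv sv; apply: (IH v _ wv).2; rewrite sv.
  - by move=> h; exfalso; lia.
  (* With e' prefixed, t0 becomes a word of the size of t', so the outer induction hypothesis
     applies. *)
  move=> t0 w0 s0 h0 NB0 NE0; apply/weight_inj_cons_std; apply: (IH _ _ _).2.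
  - by rewrite /= size_map s0.
  - exact: std_word_cons_std.
  - by move/bad_cons_std => [].
have [IH1 IH2] : (bad_cons e'.+1 t' -> ~ row_weight_inj e'.+1 t') /\ (~ bad t' ->
  ~ bad_cons e'.+1 t' -> row_weight_inj e'.+1 t').
  by apply: IHk; rewrite addSnnS.
split=> [hb|NB NE]; first by apply: not_row_weight_inj_bad_cons hb => //; apply: child.
apply: row_weight_inj_good => //; first lia.
- by move=> v wv sv; apply: (IH v _ wv).2; rewrite sv.
- by move=> _; apply: IH2.
move=> t0 w0 s0 h0 NB0 NE0; apply/weight_inj_cons_std; apply: (IH _ _ _).2.
- by rewrite /= size_map s0.
- exact: std_word_cons_std.
- by move/bad_cons_std => [].
Qed.

(** * The nilCoxeter operators *)

Import GRing.Theory.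

(** Multiplication by s_i on the side of positions; it commutes with [swapv], which acts on
    values. *)
Definition swapp i (w : seq nat) := [seq nth 0 w (tau i k) | k <- iota 0 (size w)].

Lemma tau_lt i k n : k < n -> i.+1 < n -> tau i k < n.
Proof. by rewrite /tau; do !case: ifP; lia. Qed.

Lemma size_swapp i w : size (swapp i w) = size w.
Proof. by rewrite size_map size_iota. Qed.

Lemma nth_swapp i w k : i.+1 < size w -> nth 0 (swapp i w) k = nth 0 w (tau i k).
Proof.
move=> hi; have [hk|hk] := ltnP k (size w).
  by rewrite (nth_map 0) ?size_iota // nth_iota.
by rewrite !nth_default ?size_swapp // tau_far; lia.
Qed.

Lemma swappK i w : i.+1 < size w -> swapp i (swapp i w) = w.
Proof.
move=> hi; apply: (@eq_from_nth _ 0); rewrite ?size_swapp // => k hk.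
by rewrite !nth_swapp ?size_swapp // tauK.
Qed.

Lemma swapv_swapp i j w : i.+1 < size w -> swapv j (swapp i w) = swapp i (swapv j w).
Proof.
move=> hi; rewrite /swapp size_swapv /swapv -map_comp; apply/eq_in_map => k /=.
rewrite mem_iota add0n => hk; rewrite (nth_map 0) // /tau; do !case: ifP; lia.
Qed.

Lemma index_swapp i w (v : nat) : i.+1 < size w -> std_word w ->
  index v (swapp i w) = tau i (index v w).
Proof.
move=> hi hw; have hu := std_word_uniq hw.
have hus : uniq (swapp i w).
  rewrite map_inj_in_uniq ?iota_uniq // => a b; rewrite !mem_iota !add0n /= => ha hb.
  by move/eqP; rewrite nth_uniq ?tau_lt // => /eqP /tau_inj.
have [hv|hv] := boolP (v \in w); last first.
  have nv : v \notin swapp i w.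
    apply: contra hv => /mapP[k]; rewrite mem_iota add0n /= => hk ->.
    by apply: mem_nth; apply: tau_lt.
  rewrite (memNindex nv) (memNindex hv) size_swapp.
  by rewrite tau_far // neq_ltn ?hi ?(ltnW hi) orbT.
have hl : tau i (index v w) < size (swapp i w).
  by rewrite size_swapp tau_lt // index_mem.
by rewrite -{1}(nth_index 0 hv) -{1}(tauK i (index v w)) -nth_swapp // index_uniq.
Qed.

Lemma std_word_swapp i w : i.+1 < size w -> std_word w -> std_word (swapp i w).
Proof.
move=> hi hw; 
apply: std_wordI.
  rewrite map_inj_in_uniq ?iota_uniq // => a b; rewrite !mem_iota !add0n /= => ha hb.
  by move/eqP; rewrite nth_uniq ?tau_lt ?std_word_uniq // => /eqP /tau_inj.
move=> v /mapP[k]; rewrite mem_iota add0n /= => hk ->.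
by rewrite size_swapp -std_word_mem // mem_nth // tau_lt.
Qed.

(** Letters a, b stand at positions i, i.+1, and p0, p1 are the positions of j, j.+1. Either order
    of the two swaps removes two inversions or neither does; if they exchange the same two letters,
    both sides are false. *)
Lemma tau_exchange i j a b p0 p1 : a != b -> (a == j) = (p0 == i) -> (a == j.+1) = (p1 == i) ->
  (b == j) = (p0 == i.+1) -> (b == j.+1) = (p1 == i.+1) ->
  (p1 < p0) && (tau j b < tau j a) = (b < a) && (tau i p1 < tau i p0).
Proof. by rewrite /tau; do !case: eqP; lia. Qed.

Section Ops.
Variable R : comNzRingType.
Local Open Scope ring_scope.
Implicit Types (f g : seq nat -> R) (x y : R) (t : seq nat).

(** The nilCoxeter generator u_j acting on functions on words; [expu] is 1 + y u_j. *)
Definition nilu j f t := if invv j t then f (swapv j t) else 0.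
Definition expu j y f t := f t + y * nilu j f t.

(** The product term vanishes because u_j squares to zero. *)
Lemma expu_add j x y f : expu j x (expu j y f) = expu j (x + y) f.
Proof.
apply: functional_extensionality => t; rewrite /expu /nilu /invv !index_swapv tauL tauR.
by case: ltngtP => _; ring.
Qed.

Lemma expu0 j f : expu j 0 f = f.
Proof. by apply: functional_extensionality => t; rewrite /expu mul0r addr0. Qed.

Lemma expu_comm i j x y f : (i.+1 < j)%N -> expu i x (expu j y f) = expu j y (expu i x f).
Proof.
move=> h; apply: functional_extensionality => t; rewrite /expu /nilu /invv !index_swapv.
rewrite (@tau_far i j) ?(@tau_far i j.+1) ?(@tau_far j i) ?(@tau_far j i.+1); try lia.
rewrite (swapv_comm _ h).
by case: (index i.+1 t < index i t)%N; case: (index j.+1 t < index j t)%N => /=; ring.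
Qed.

Lemma yang_baxter j x y f :
  expu j x (expu j.+1 (x + y) (expu j y f)) = expu j.+1 y (expu j (x + y) (expu j.+1 x f)).
Proof.
have ta : tau j j.+2 = j.+2 by rewrite tau_far //; lia.
have tb : tau j.+1 j = j by rewrite tau_far //; lia.
apply: functional_extensionality => t; rewrite /expu /nilu /invv.
rewrite !(index_swapv, tauL, tauR, ta, tb) swapv_braid.
set p0 := index j t; set p1 := index j.+1 t; set p2 := index j.+2 t.
by case: (ltngtP p1 p0) => h1; case: (ltngtP p2 p1) => h2; case: (ltngtP p2 p0) => h3;
  try (exfalso; lia); rewrite ?swapvK; ring.
Qed.

(* (1 + y u_{lo+k-1}) ... (1 + y u_lo), with u_j the generators of the nilCoxeter algebra. *)
Fixpoint rowop k lo y f := if k is k'.+1 then expu (lo + k') y (rowop k' lo y f) else f.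

Lemma rowop_split k1 k2 lo y f : rowop (k1 + k2) lo y f = rowop k2 (lo + k1) y (rowop k1 lo y f).
Proof. by elim: k2 => [|k2 IH]; rewrite ?addn0 ?addnS //= IH addnA. Qed.

Lemma rowop_rec k lo y f : rowop k.+1 lo y f = rowop k lo.+1 y (expu lo y f).
Proof. by rewrite -add1n rowop_split /= addn0 addn1. Qed.

Lemma expu_rowop i k lo x y f : (i.+1 < lo)%N ->
  expu i x (rowop k lo y f) = rowop k lo y (expu i x f).
Proof. by move=> h; elim: k => //= k IH; rewrite expu_comm ?IH //; lia. Qed.

(** Peel u_lo off both rows, let the rows from lo.+1 on commute by induction, and reorder the
    remaining factors in u_lo and u_{lo+1} by Yang-Baxter. *)
Lemma rowop_comm k lo x y f : rowop k lo x (rowop k lo y f) = rowop k lo y (rowop k lo x f).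
Proof.
elim: k lo f => // -[|k] IH lo f; first by rewrite /= !expu_add addrC.
rewrite !(rowop_rec k.+1 lo) [in LHS](rowop_rec k lo.+1 y) expu_rowop //.
set F := expu lo x _.
(* Inserting (1 + y u)(1 - y u) = 1 with u = u_{lo+1} completes the inner row, so that the induction
   hypothesis applies. *)
have -> : rowop k lo.+2 y F = rowop k.+1 lo.+1 y (expu lo.+1 (- y) F).
  by rewrite rowop_rec expu_add subrr expu0.
rewrite IH [rowop k.+1 lo.+1 x (expu lo.+1 _ _)]rowop_rec expu_add /F; congr (rowop _ _ _ _).
have e1 : x = y + (x - y) by ring.
have := yang_baxter lo y (x - y) (expu lo y f); rewrite -e1 => <-.
by rewrite expu_add subrK -expu_rowop // -rowop_rec.
Qed.

Lemma nilu_linear j c f g : nilu j (fun t => f t + c * g t) = (fun t => nilu j f t + c * nilu j g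
  t).
Proof. by apply: functional_extensionality => t; rewrite /nilu; case: ifP => _; ring. Qed.

Lemma rowop_linear k lo y c f g :
  rowop k lo y (fun t => f t + c * g t) = (fun t => rowop k lo y f t + c * rowop k lo y g t).
Proof.
elim: k => //= k ->; apply: functional_extensionality => t.
by rewrite /expu nilu_linear; ring.
Qed.

(** Completing the shorter row by u_lo makes the two rows commute; the correction 1 - y u_lo then
    merges with 1 + x u_lo into 1 + (x - y) u_lo. *)
Lemma two_rows k lo x y f :
  rowop k.+1 lo x (rowop k lo.+1 y f) =
  (fun t => rowop k.+1 lo y (rowop k lo.+1 x f) t + (x - y) * rowop k.+1 lo y (rowop k lo.+1 x
    (nilu lo f)) t).
Proof.
have -> : rowop k lo.+1 y f = rowop k.+1 lo y (expu lo (- y) f) by rewrite rowop_rec expu_add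
  subrr expu0.
rewrite rowop_comm [in rowop k.+1 lo x _]rowop_rec expu_add.
have -> : expu lo (x - y) f = (fun t => f t + (x - y) * nilu lo f t) by [].
by rewrite !rowop_linear.
Qed.

(** The staircase product of Fomin and Stanley, with u_{i+m-2}, ..., u_i in row i. Applied to
    [delta], its value at w is the coefficient of w. *)
Fixpoint rowsop m i (x : nat -> R) f := if m is m'.+1 then rowop m' i (x i) (rowsop m' i.+1 x f)
  else f.

Lemma nilu_comm i j f : (i.+1 < j)%N -> nilu i (nilu j f) = nilu j (nilu i f).
Proof.
move=> h; apply: functional_extensionality => t; rewrite /nilu /invv !index_swapv.
rewrite (@tau_far i j) ?(@tau_far i j.+1) ?(@tau_far j i) ?(@tau_far j i.+1); try lia.
rewrite (swapv_comm _ h).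
by case: (index i.+1 t < index i t)%N; case: (index j.+1 t < index j t)%N.
Qed.

Lemma nilu_rowop i k lo y f : (i.+1 < lo)%N -> nilu i (rowop k lo y f) = rowop k lo y (nilu i f).
Proof. by move=> h; elim: k => //= k IH;
  rewrite /expu nilu_linear (@nilu_comm i (lo + k)) ?IH //; lia. Qed.

Lemma nilu_rowsop j m i (x : nat -> R) f : (j.+1 < i)%N ->
  nilu j (rowsop m i x f) = rowsop m i x (nilu j f).
Proof. by elim: m i => //= m IH i h; rewrite nilu_rowop ?IH //; lia. Qed.

Lemma rowsop_ext m i (x x' : nat -> R) f : (forall k, (i <= k)%N -> x k = x' k) ->
  rowsop m i x f = rowsop m i x' f.
Proof. by elim: m i => //= m IH i h; rewrite h // (IH i.+1) // => k hk; apply: h; lia. Qed.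

(** Only rows i and i.+1 involve the exchanged variables. [two_rows] produces x_i - x_{i+1} together
    with u_i, which commutes with the later rows; the earlier rows are linear. *)
Lemma rowsop_ddiff m i0 i (x : nat -> R) f : (i0 <= i)%N -> (i.+1 < i0 + m)%N ->
  rowsop m i0 x f = (fun t => rowsop m i0 (x \o tau i) f t + (x i - x i.+1) * rowsop m i0 x (nilu
    i f) t).
Proof.
elim: m i0 => [|m IH] i0 h1 h2; first lia.
have [E|N] := eqVneq i0 i; last first.
  have e : tau i i0 = i0 by rewrite tau_far //; lia.
  have h1' : (i0 < i)%N by lia.
  have h2' : (i.+1 < i0.+1 + m)%N by lia.
  by rewrite /= e (IH _ h1' h2') rowop_linear.
subst i0; case: m IH h2 => [|m] _ h2; first lia.
have e : rowsop m i.+2 x f = rowsop m i.+2 (x \o tau i) f.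
  by apply: rowsop_ext => k hk; rewrite /= tau_far //; lia.
rewrite /= tauL tauR -e.
apply: functional_extensionality => t.
have /(congr1 (@^~ t)) /= := two_rows m i (x i.+1) (x i) (rowsop m i.+2 x f).
by rewrite nilu_rowsop // => ->; ring.
Qed.

Definition delta n t : R := (t == iota 0 n)%:R.

(** The counterpart of [nilu] for positions. The two commute on standard words and agree on [delta],
    so u_i at the end of the product becomes a swap of the positions i and i.+1 of w. *)
Definition rdiff i f t := if (nth 0%N t i.+1 < nth 0%N t i)%N then f (swapp i t) else 0.

Lemma nilu_rdiff i j f w : (i.+1 < size w)%N -> std_word w ->
  nilu j (rdiff i f) w = rdiff i (nilu j f) w.
Proof.
move=> hi hw; have hu := std_word_uniq hw; have hi' := ltnW hi.
rewrite /nilu /rdiff /invv !(index_swapp _ hi hw) !nth_swapv // (swapv_swapp _ hi).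
have ix v k : (k < size w)%N -> (nth 0%N w k == v) = (index v w == k).
  move=> hk; apply/eqP/eqP => [<-|h]; first exact: index_uniq.
  by apply: (index_inj (mem_nth 0%N hk)); rewrite index_uniq.
have nab : nth 0%N w i != nth 0%N w i.+1 by rewrite nth_uniq // neq_ltn ltnSn.
have := tau_exchange nab (ix j i hi') (ix j.+1 i hi') (ix j i.+1 hi) (ix j.+1 i.+1 hi).
by do !case: ifP => //= _.
Qed.

Lemma rdiff_linear i c f g : rdiff i (fun t => f t + c * g t) = (fun t => rdiff i f t + c * rdiff
  i g t).
Proof. by apply: functional_extensionality => t; rewrite /rdiff; case: ifP => _; ring. Qed.

Definition eqD n i f g := forall w, size w = n -> std_word w -> f w = rdiff i g w.

Lemma eqD_expu n i j y f g : (i.+1 < n)%N -> eqD n i f g -> eqD n i (expu j y f) (expu j y g).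
Proof.
move=> hi h w sw_ ww; rewrite /expu rdiff_linear h // -nilu_rdiff ?sw_ //.
congr (_ + _ * _); rewrite /nilu; case: ifP => // hj.
by apply: h; rewrite ?size_swapv //; apply: std_word_swapv.
Qed.

Lemma eqD_rowsop n i m i0 (x : nat -> R) f g : (i.+1 < n)%N -> eqD n i f g ->
  eqD n i (rowsop m i0 x f) (rowsop m i0 x g).
Proof.
move=> hi h; elim: m i0 => //= m IH i0.
have : forall k, eqD n i (rowop k i0 (x i0) (rowsop m i0.+1 x f)) (rowop k i0 (x i0) (rowsop m
  i0.+1 x g)).
  by elim=> [|k IHk] //=; apply: eqD_expu.
by apply.
Qed.

Lemma eqD_delta n i : (i.+1 < n)%N -> eqD n i (nilu i (delta n)) (delta n).
Proof.
move=> hi w sw_ ww; rewrite /nilu /rdiff /delta.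
have e1 : swapp i (iota 0 n) = swapv i (iota 0 n).
  rewrite /swapp size_iota /swapv; apply/eq_in_map => k; rewrite mem_iota add0n => hk.
  by rewrite nth_iota ?tau_lt.
have -> : (swapv i w == iota 0 n) = (w == swapv i (iota 0 n)).
  by apply/eqP/eqP => [<-|->]; rewrite swapvK.
have -> : (swapp i w == iota 0 n) = (w == swapv i (iota 0 n)).
  rewrite -e1; apply/eqP/eqP => [<-|->]; rewrite swappK ?sw_ ?size_iota //.
have [E|_] := eqVneq w (swapv i (iota 0 n)); last by do !case: ifP.
have ii k : (k < n)%N -> index k (iota 0 n) = k.
  by move=> hk; rewrite -{1}(nth_iota 0 0 hk : _ = k) index_uniq ?size_iota ?iota_uniq.
have hi' := ltnW hi.
have -> : invv i w by rewrite /invv E !index_swapv tauL tauR !ii.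
have -> // : (nth 0%N w i.+1 < nth 0%N w i)%N.
by rewrite E !nth_swapv ?size_iota // !nth_iota // !add0n tauL tauR.
Qed.

Theorem rowsop_ddiff_perm n i (x : nat -> R) w : (i.+1 < n)%N -> size w = n -> std_word w ->
  (nth 0%N w i < nth 0%N w i.+1)%N ->
  rowsop n 0 x (delta n) (swapp i w) - rowsop n 0 (x \o tau i) (delta n) (swapp i w) =
  (x i - x i.+1) * rowsop n 0 x (delta n) w.
Proof.
move=> hi sw_ ww ha; have hi' : (i.+1 < size w)%N by rewrite sw_.
have := rowsop_ddiff x (delta n) (leq0n i) (hi : (i.+1 < 0 + n)%N).
move/(congr1 (@^~ (swapp i w))) => /= ->.
rewrite (eqD_rowsop _ _ _ hi (eqD_delta hi)) ?size_swapp //; last exact: std_word_swapp.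
by rewrite /rdiff !nth_swapp // tauL tauR ha swappK //; ring.
Qed.
End Ops.

(** * Expansion of the operators over pipe dreams *)

Fixpoint rows_of k lo t : seq (seq nat) :=
  if k is k'.+1 then
    rows_of k' lo t ++ (if invv (lo + k') t then [seq lo + k' :: T | T <- rows_of k' lo (swapv
      (lo + k') t)]
                     else [::])
  else [:: [::]].

Lemma mem_rows k lo t T : (T \in rows_of k lo t) = is_row lo T t && all (gtn (lo + k)) T.
Proof.
elim: k t T => [|k IH] t T /=.
  rewrite inE addn0; case: T => // j T; rewrite row_cons /=.
  by apply/esym/negbTE; apply/negP; lia.
rewrite mem_cat IH addnS; case: T => [|j T]; first by rewrite /is_row.
rewrite row_cons.
have [E|N] := eqVneq j (lo + k).
  subst j; rewrite leq_addr /= ltnn andbF ltnSn /=.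
  case: ifP => //= hi.
  rewrite mem_map; last by move=> ? ? [].
  rewrite IH; case: (is_row _ _ _); rewrite ?andbF //=.
  case h : (all (gtn (lo + k)) T) => //=.
  by apply/esym; apply: sub_all h => i /=; lia.
have -> : (j :: T \in (if invv (lo + k) t then [seq lo + k :: T0 | T0 <- rows_of k lo (swapv (lo
  + k) t)]
    else [::])) = false.
  by case: ifP => // _; apply/negP => /mapP[T0 _ [E]]; move: N; rewrite E eqxx.
rewrite orbF /=.
case: (lo <= j) => //=; case: (invv j t) => //=; case hT : (all (gtn j) T) => //=.
case: (is_row _ _ _) => //=.
have [h|h] := ltnP j (lo + k).
  by rewrite /= (leq_trans h) //=; apply/idP/idP => _; apply: sub_all hT => i /=; lia.
by rewrite /= ltnS leq_eqVlt (negbTE N) /= ltnNge h.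
Qed.

Lemma rows_uniq k lo t : uniq (rows_of k lo t).
Proof.
elim: k t => //= k IH t; rewrite cat_uniq IH /=; case: ifP => //= _.
rewrite map_inj_uniq ?IH ?andbT; last by move=> ? ? [].
apply/hasPn => _ /mapP[T _ ->]; rewrite /= mem_rows /=.
by rewrite ltnn !andbF.
Qed.

(** A row swaps j and j.+1 with j.+1 < m', so its entries range over m'.-1 - e values from e on. *)
Fixpoint pipe_dreams m (w : seq nat) : seq (seq (seq nat)) :=
  if m is m'.+1 then
    if w is e :: t then [seq T :: D | T <- rows_of (m'.-1 - e) e (unbumps e t), D <- pipe_dreams
      m' (app_row T (unbumps e t))]
    else [::]
  else [:: [::]].

Lemma row_bound e T t : std_word t -> is_row e T t -> all (gtn (e + ((size t).-1 - e))) T.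
Proof.
move=> w; elim: T t w => // j T IH t w; rewrite row_cons => /and4P[h1 h2 h3 h4].
have := invv_mem h2; rewrite std_word_mem // => hj; rewrite /=; apply/andP; split; first lia.
by have := IH _ (std_word_swapv w h2) h4; rewrite size_swapv.
Qed.

Lemma mem_pipe_dreams m w D : std_word w -> size w = m -> (D \in pipe_dreams m w) = pipe_dream D w.
Proof.
elim: m w D => [|m IH] [|e t] // D ww; first by rewrite inE; case: D.
move=> /= [st]; have [he w' _] := std_word_cons ww.
have st' : size (unbumps e t) = m by rewrite size_map.
apply/allpairsPdep/idP => [[T [D' [hT hD ->]]]|].
  move: hT; rewrite mem_rows => /andP[hr _] /=; rewrite hr /= -IH ?size_app_row //.
  by apply: std_word_app_row => //; case/and3P: hr.
case: D => // T D /= /andP[hr hp]; exists T, D; split=> //.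
  by rewrite mem_rows hr -st' row_bound.
by rewrite IH ?size_app_row //; apply: std_word_app_row => //; case/and3P: hr.
Qed.

Lemma pipe_dreams_uniq m w : uniq (pipe_dreams m w).
Proof.
elim: m w => [|m IH] [|e t] //=; apply: allpairs_uniq_dep => //; first exact: rows_uniq.
by move=> [T D] [T' D'] /= _ _ [-> ->].
Qed.

Lemma size_weight D w : std_word w -> pipe_dream D w -> size (weight D w) = size w.
Proof.
elim: D w => [|T D IH] [|e t] //= ww /andP[hr hp]; rewrite IH ?size_app_row ?size_map //.
by have [_ w' _] := std_word_cons ww; apply: std_word_app_row => //; case/and3P: hr.
Qed.

Section Expand.
Variable R : comNzRingType.
Local Open Scope ring_scope.
Implicit Types (f g : seq nat -> R) (y : R) (x : nat -> R) (t : seq nat).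

Lemma rowop_rows k lo y f t : rowop k lo y f t = \sum_(T <- rows_of k lo t) y ^+ size T * f
  (app_row T t).
Proof.
elim: k t => [|k IH] t /=; first by rewrite big_seq1 expr0 mul1r.
rewrite big_cat /= -IH /expu /nilu; case: ifP => _; last by rewrite big_nil mulr0.
rewrite big_map (IH (swapv _ _)) mulr_sumr; congr (_ + _); apply: eq_bigr => T _ /=.
by rewrite exprS mulrA app_row_cons.
Qed.

Lemma rowop_cons_std a k lo y f t : (a <= lo)%N ->
  rowop k lo.+1 y f (cons_std a t) = rowop k lo y (fun s => f (cons_std a s)) t.
Proof.
move=> h; elim: k t => //= k IH t;
  rewrite /expu /nilu addSn invv_cons_std_ge ?swapv_cons_std_ge ?IH //; lia.
Qed.

Lemma rowsop_cons_std0 m i x f t : rowsop m i.+1 x f (cons_std 0 t) = rowsop m i (fun k => x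
  k.+1) (fun s => f (cons_std 0 s)) t.
Proof.
elim: m i t => //= m IH i t; rewrite rowop_cons_std //; congr (rowop _ _ _ _ _).
by apply: functional_extensionality => s; rewrite IH.
Qed.

(** Rows after the first swap only values from 1 on, so a positive first letter never becomes 0. *)
Lemma rowsop_head m i x f v t : (forall v t, (0 < v)%N -> f (v :: t) = 0) -> (0 < v)%N ->
  rowsop m i.+1 x f (v :: t) = 0.
Proof.
move=> hf; elim: m i v t => [|m IH] i v t hv /=; first exact: hf.
move: (rowsop m i.+2 x f) (IH i.+1) => g hg.
have : forall k v t, (0 < v)%N -> rowop k i.+1 (x i.+1) g (v :: t) = 0.
  elim=> [|k IHk] u s hu /=; first exact: hg.
  rewrite /expu /nilu IHk // /swapv /= IHk; first by case: ifP => _; rewrite mulr0 addr0.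
  by rewrite /tau; do !case: ifP; lia.
by apply.
Qed.

Lemma delta_cons_std0 n t : delta R n.+1 (cons_std 0 t) = delta R n t.
Proof.
have e : iota 0 n.+1 = cons_std 0 (iota 0 n).
  by rewrite /cons_std -[iota 0 n.+1]/(0%N :: iota (1 + 0) n) iotaDl; congr cons; apply: eq_map.
rewrite /delta e /cons_std eqseq_cons eqxx /= inj_eq //; exact: inj_map (@bumpv_inj 0).
Qed.

Lemma rowop_below k y g v t : (forall v t, (0 < v)%N -> g (v :: t) = 0) -> (k < v)%N ->
  rowop k 0 y g (v :: t) = 0.
Proof.
move=> hg; elim: k v t => [|k IH] v t hk /=; first exact: hg.
rewrite /expu /nilu IH; last lia.
rewrite /swapv /= add0n tau_far ?IH; try lia.
by case: ifP => _; rewrite mulr0 addr0.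
Qed.

(** All e swaps are needed to bring the first letter down to 0; skipping one leaves it positive. *)
Lemma rowop_drop e y g t : (forall v t, (0 < v)%N -> g (v :: t) = 0) ->
  rowop e 0 y g (cons_std e t) = y ^+ e * g (cons_std 0 t).
Proof.
move=> hg; elim: e t => [|e IH] t /=; first by rewrite mul1r.
rewrite /expu /nilu add0n swapv_cons_std IH /cons_std rowop_below // add0r.
have -> : invv e (e.+1 :: map (bumpv e.+1) t).
  by rewrite /invv /= eqxx; case: eqP => //; lia.
by rewrite exprS mulrA.
Qed.

(** The swaps below e are forced and give x_0^e, the swap e is impossible with e in front of e.+1,
    and the swaps from e.+1 on act on t, shifted by one. *)
Lemma rowsop_rec n x e t : (e <= n)%N ->
  rowsop n.+1 0 x (delta R n.+1) (cons_std e t) =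
  x 0%N ^+ e * rowop (n.-1 - e) e (x 0%N) (rowsop n 0 (fun k => x k.+1) (delta R n)) t.
Proof.
move=> he; rewrite [LHS]/=; set G := rowsop n 1 x (delta R n.+1).
have hG v s : (0 < v)%N -> G (v :: s) = 0.
  by move=> hv; apply: rowsop_head => // u r hu; rewrite /delta; case: eqP => // -[]; lia.
have G0 s : G (cons_std 0 s) = rowsop n 0 (fun k => x k.+1) (delta R n) s.
  rewrite /G rowsop_cons_std0; congr (rowsop _ _ _ _ _).
  by apply: functional_extensionality => r; apply: delta_cons_std0.
have [E|N] := eqVneq e n.
  by subst e; rewrite (_ : n.-1 - n = 0)%N; [rewrite rowop_drop // G0 | lia].
have en : n = (e.+1 + (n.-1 - e))%N by lia.
rewrite [X in rowop X 0]en rowop_split add0n rowop_cons_std //.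
have -> : (fun s => rowop e.+1 0 (x 0%N) G (cons_std e s)) =
    (fun s => 0 + x 0%N ^+ e * rowsop n 0 (fun k => x k.+1) (delta R n) s).
  apply: functional_extensionality => s; rewrite /= /expu /nilu add0n rowop_drop // G0 add0r.
  by rewrite (_ : invv e (cons_std e s) = false) ?mulr0 ?addr0 // /invv /= eqxx ltn0.
by rewrite (rowop_linear _ _ _ _ (fun=> 0)) rowop_rows big1 ?add0r // => T _; rewrite mulr0.
Qed.

Lemma rowsop_pipe_dreams n x w : std_word w -> size w = n ->
  rowsop n 0 x (delta R n) w = \sum_(D <- pipe_dreams n w) \prod_(i < n) x i ^+ nth 0%N (weight D
    w) i.
Proof.
elim: n x w => [|n IH] x [|e t] // ww; first by rewrite big_seq1 big_ord0 /= /delta eqxx.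
move=> [st]; have [he w' E] := std_word_cons ww.
have st' : size (unbumps e t) = n by rewrite size_map.
rewrite {1}E rowsop_rec; last by rewrite -st' size_map.
rewrite rowop_rows mulr_sumr /= big_allpairs_dep /= big_seq [RHS]big_seq.
apply: eq_bigr => T; rewrite mem_rows => /andP[hr _].
have wa : std_word (app_row T (unbumps e t)) by apply: std_word_app_row => //; case/and3P: hr.
rewrite IH ?size_app_row // mulrA -exprD mulr_sumr; apply: eq_bigr => D _.
by rewrite big_ord_recl.
Qed.
End Expand.

(** * Schubert polynomials *)

Section Morph.
Local Open Scope ring_scope.
Variables (R R' : comNzRingType) (h : {rmorphism R -> R'}).

Lemma rowop_morph k lo y (f : seq nat -> R) (g : seq nat -> R') t :
  (forall t, h (f t) = g t) -> h (rowop k lo y f t) = rowop k lo (h y) g t.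
Proof.
move=> hf; elim: k t => //= k IH t; rewrite /expu /nilu rmorphD rmorphM IH.
by case: ifP; rewrite ?IH ?rmorph0.
Qed.

Lemma rowsop_morph m i (x : nat -> R) n t :
  h (rowsop m i x (delta R n) t) = rowsop m i (h \o x) (delta R' n) t.
Proof.
elim: m i t => [|m IH] i t /=; first by rewrite /delta rmorph_nat.
by apply: rowop_morph => s; apply: IH.
Qed.
End Morph.

Section Top.
Local Open Scope ring_scope.

Lemma rowsop_top (R : comNzRingType) n (x : nat -> R) :
  rowsop n 0 x (delta R n) (rev (iota 0 n)) = \prod_(i < n) x i ^+ (n - 1 - i).
Proof.
elim: n x => [|n IH] x; first by rewrite big_ord0 /= /delta eqxx.
have -> : rev (iota 0 n.+1) = cons_std n (rev (iota 0 n)).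
  rewrite -addn1 iotaD rev_cat /cons_std add0n /=; congr cons.
  rewrite -[LHS]map_id; apply/eq_in_map => v; rewrite mem_rev mem_iota add0n /bumpv.
  by case: leqP => //; lia.
rewrite rowsop_rec // (_ : n.-1 - n = 0)%N; last by lia.
rewrite [rowop _ _ _ _ _]IH big_ord_recl /= subn0 subn1 /=; congr (_ * _); first by rewrite subn1.
by apply: eq_bigr => i _; congr (_ ^+ _); rewrite /bump /=; lia.
Qed.
End Top.

(** * Permutations as words, and the divided difference recursion *)

Section Link.
Variable n : nat.
Implicit Types (w : 'S_n) (i : 'I_n).

Definition one_line w : seq nat := [seq val (w i) | i <- enum 'I_n].

Lemma size_one_line w : size (one_line w) = n.
Proof. by rewrite size_map size_enum_ord. Qed.

Lemma nth_one_line w i : nth 0 (one_line w) i = w i.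
Proof. by rewrite (nth_map i) ?size_enum_ord // nth_ord_enum. Qed.

Lemma std_word_one_line w : std_word (one_line w).
Proof.
apply: std_wordI; first by rewrite map_inj_uniq ?enum_uniq // => i j /val_inj /perm_inj.
by move=> v /mapP[i _ ->]; rewrite size_one_line; apply: ltn_ord.
Qed.

Lemma index_one_line w i : index (w i : nat) (one_line w) = i.
Proof. by rewrite -nth_one_line index_uniq ?size_one_line // std_word_uniq // std_word_one_line.
  Qed.

Lemma val_nxt i : (i.+1 < n)%N -> nxt i = i.+1 :> nat.
Proof. by move=> h; rewrite /nxt val_insubd h. Qed.

Lemma val_stp i k : (i.+1 < n)%N -> stp i k = tau i k :> nat.
Proof.
move=> h; rewrite /stp /tau; case: tpermP => [->|->|h1 h2].
- by rewrite eqxx val_nxt.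
- by rewrite val_nxt //; case: eqP => [|_]; [lia | rewrite eqxx].
rewrite (negbTE (introN eqP _)); last by move/val_inj.
by rewrite (negbTE (introN eqP _)) // -(val_nxt h) => /val_inj.
Qed.

Lemma one_line_wsi w i : (i.+1 < n)%N -> one_line (wsi w i) = swapp i (one_line w).
Proof.
move=> h; apply: (@eq_from_nth _ 0); rewrite ?size_swapp ?size_one_line // => k hk.
rewrite nth_swapp ?size_one_line // -(val_stp (Ordinal hk) h) -[k]/(val (Ordinal hk)) !nth_one_line.
by rewrite /wsi permM.
Qed.

Local Open Scope ring_scope.

(** Indices from n on get the value 0, which every [msym] fixes. *)
Definition vars k : {mpoly int[n]} := if insub k is Some i then 'X_i else 0.

Lemma varsE i : vars i = 'X_i.
Proof. by rewrite /vars valK. Qed.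

Definition schub w : {mpoly int[n]} := rowsop n 0 vars (delta _ n) (one_line w).

Lemma msymXU (s : 'S_n) i : msym s ('X_i : {mpoly int[n]}) = 'X_(s i).
Proof.
rewrite msymX; congr 'X_[_]; apply/mnmP => j; rewrite mnmE !mnm1E.
by congr nat_of_bool; apply/eqP/eqP => [->|<-]; rewrite ?permKV ?permK.
Qed.

Lemma msym_vars i k : (i.+1 < n)%N -> msym (stp i) (vars k) = vars (tau i k).
Proof.
move=> h; rewrite {1}/vars; case: insubP => [j hj ej|hk].
  by rewrite msymXU -varsE val_stp // ej.
rewrite msym0 /vars insubF // tau_far; try lia.
Qed.

Lemma ddiffE i (f g : {mpoly int[n]}) : (i.+1 < n)%N ->
  f - msym (stp i) f = ('X_i - 'X_(nxt i)) * g -> ddiff i f = g.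
Proof.
move=> h e; rewrite /ddiff.
have := epsilon_spec (inhabits 0) (fun g => f - msym (stp i) f = ('X_i - 'X_(nxt i)) * g)
  (ex_intro _ g e).
rewrite {1}e => /mulfI -> //.
(* The coefficient of x_i shows that x_i - x_{i+1} is nonzero, so the quotient chosen by [epsilon]
   is g. *)
rewrite subr_eq0; apply/eqP => /(congr1 (mcoeff U_(i))).
rewrite !mcoeffXU eqxx; case: eqP => // E.
by have := val_nxt h; rewrite E; lia.
Qed.

Lemma schub_ascent w i : ascent w i -> ddiff i (schub (wsi w i)) = schub w.
Proof.
case/andP => h1 h2; apply: ddiffE => //.
rewrite -!varsE val_nxt // /schub one_line_wsi //.
rewrite (rowsop_morph (msym (stp i) : {rmorphism {mpoly int[n]} -> {mpoly int[n]}})).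
rewrite (_ : _ \o vars = vars \o tau i); last first.
  by apply: functional_extensionality => k /=; apply: msym_vars.
apply: rowsop_ddiff_perm; rewrite ?size_one_line //; first exact: std_word_one_line.
by rewrite -(val_nxt h1) !nth_one_line.
Qed.
End Link.

Lemma ltn_tau i a b : a < b -> ~~ ((a == i) && (b == i.+1)) -> tau i a < tau i b.
Proof. by rewrite /tau; do !case: ifP; lia. Qed.

(** * Unfolding the recursion, coefficients, and pattern containment *)

Section Final.
Variable n : nat.
Implicit Types (w : 'S_n) (i : 'I_n).

(** The measure of the recursion: each step at an ascent lowers the number of these pairs, which is
    at most the fuel n * n. *)
Definition noninv w := [set p : 'I_n * 'I_n | (p.1 < p.2) && (w p.1 < w p.2)].

Lemma noninv_wsi w i : ascent w i -> #|noninv (wsi w i)| < #|noninv w|.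
Proof.
case/andP => h1 h2; pose h (p : 'I_n * 'I_n) := (stp i p.1, stp i p.2).
have hinj : injective h by move=> [a b] [c d] [/perm_inj-> /perm_inj->].
rewrite -(card_imset _ hinj); apply: proper_card; apply/properP; split.
  apply/subsetP => p /imsetP[[a b] hp ->]; move: hp.
  rewrite !inE /= /wsi !permM => /andP[hab hw].
  rewrite /h /= hw andbT !val_stp //; apply: ltn_tau => //; apply/negP => /andP[/eqP ea /eqP eb].
  move: hw; have -> : a = i by apply: val_inj.
  have -> : b = nxt i by apply: val_inj; rewrite /= val_nxt.
  by rewrite tpermL tpermR; move: h2; lia.
exists (i, nxt i); first by rewrite inE /= val_nxt // ltnSn.
apply/imsetP => -[[a b]]; rewrite inE /= => /andP[hab _] [ea eb].
have := congr1 (stp i) ea; have := congr1 (stp i) eb.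
rewrite /stp !tpermK tpermL tpermR => eb' ea'.
by move: hab; rewrite -eb' -ea' val_nxt //; lia.
Qed.

Lemma one_line_w0 : one_line (w0 n) = rev (iota 0 n).
Proof.
apply: (@eq_from_nth _ 0); rewrite ?size_rev ?size_iota size_one_line // => k hk.
rewrite nth_rev ?size_iota // nth_iota ?add0n; last by lia.
by rewrite -[k]/(val (Ordinal hk)) nth_one_line permE.
Qed.

Lemma one_line_inj : injective (@one_line n).
Proof. by move=> u w e; apply/permP => i; apply: val_inj; rewrite /= -!nth_one_line e. Qed.

Lemma no_ascent w : (forall i, ~~ ascent w i) -> w = w0 n.
Proof.
move=> h; apply: one_line_inj; rewrite one_line_w0.
apply: (irr_sorted_eq gtn_trans).
- by move=> x; rewrite /= ltnn.
- apply/(sortedP 0) => k; rewrite size_one_line => hk /=.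
  have hk' := ltnW hk; have := h (Ordinal hk'); rewrite /ascent /= hk /= -leqNgt => hle.
  move: hle; rewrite -!nth_one_line val_nxt //= leq_eqVlt => /orP[/eqP E|//].
  have := nth_uniq 0 (s := one_line w) (i := k.+1) (j := k).
  by rewrite size_one_line std_word_uniq ?std_word_one_line // E eqxx => /(_ hk hk' erefl); lia.
- by rewrite rev_sorted; exact: iota_ltn_sorted.
by move=> v; rewrite mem_rev mem_iota std_word_mem ?size_one_line //; exact: std_word_one_line.
Qed.

Lemma schub_w0 : schub (w0 n) = schub_top n.
Proof.
rewrite /schub one_line_w0 rowsop_top; apply: eq_bigr => i _.
by rewrite varsE.
Qed.

Lemma schub_auxE k w : #|noninv w| <= k -> schub_aux k w = schub w.
Proof.
elim: k w => [|k IH] w hk /=.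
  rewrite -schub_w0; congr schub; apply/esym; apply: no_ascent => i.
  by apply/negP => /noninv_wsi; lia.
case: eqP => [->|N]; first by rewrite schub_w0.
case: pickP => [i hi|h]; last by case: N; apply: no_ascent => i; rewrite h.
by rewrite IH ?schub_ascent //; have := noninv_wsi hi; lia.
Qed.

Lemma schubertE w : schubert w = schub w.
Proof.
apply: schub_auxE; apply: leq_trans (max_card _) _.
by rewrite card_prod card_ord.
Qed.

Definition pd_monom w D : 'X_{1..n} := [multinom nth 0 (weight D (one_line w)) i | i < n].

Lemma mcoeff_schubert w m :
  ((schubert w)@_m = (count_mem m (map (pd_monom w) (pipe_dreams n (one_line w))))%:R)%R.
Proof.
rewrite schubertE /schub (rowsop_pipe_dreams _ (std_word_one_line w) (size_one_line w)) raddf_sum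
  /=.
rewrite count_map -sum1_count natr_sum [RHS]big_mkcond /=; apply: eq_bigr => D _.
rewrite (_ : \prod_(i < n) _ = 'X_[pd_monom w D])%R; last first.
  by rewrite mpolyXE_id; apply: eq_bigr => i _; rewrite varsE mnmE.
by rewrite mcoeffX; case: eqP.
Qed.

Lemma pd_monom_inj w D D' : pipe_dream D (one_line w) -> pipe_dream D' (one_line w) ->
  (pd_monom w D == pd_monom w D') = (weight D (one_line w) == weight D' (one_line w)).
Proof.
move=> p p'; apply/eqP/eqP => e; last by rewrite /pd_monom e.
apply: (@eq_from_nth _ 0); rewrite !size_weight ?std_word_one_line // size_one_line // => k hk.
have /mnmP /(_ (Ordinal hk)) := e.
by rewrite !mnmE.
Qed.

(** A coefficient counts the pipe dreams of one weight, so it exceeds 1 exactly when two of them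
    share this weight. *)
Lemma zero_oneP w : zero_one (schubert w) <-> weight_inj (one_line w).
Proof.
have mp D : (D \in pipe_dreams n (one_line w)) = pipe_dream D (one_line w) by rewrite
  mem_pipe_dreams ?size_one_line ?std_word_one_line.
split=> [h D D' p p' e|h m].
  have u : uniq (map (pd_monom w) (pipe_dreams n (one_line w))).
    apply: count_mem_uniq => m; have := h m; rewrite mcoeff_schubert => hc.
    have [hin|hin] := boolP (m \in _); last by rewrite (count_memPn hin).
    have : count_mem m (map (pd_monom w) (pipe_dreams n (one_line w))) > 0 by rewrite -has_count
      has_pred1.
    move: hc; case: (count_mem _ _) => [|[|c]] // [] /eqP.
      by rewrite Num.Theory.pnatr_eq0.
    by rewrite -[1%R]/(1%:R%R) Num.Theory.eqr_nat.
  rewrite -mp in p; rewrite -mp in p'.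
  have e' : pd_monom w D = pd_monom w D' by apply/eqP; rewrite pd_monom_inj -?mp // e.
  rewrite -(nth_index [::] p) -(nth_index [::] p'); congr nth; apply/eqP.
  rewrite -(nth_uniq 0%MM _ _ u) ?size_map ?index_mem //.
  by rewrite !(nth_map [::]) ?index_mem // !nth_index // e'.
rewrite mcoeff_schubert count_uniq_mem; first by case: (m \in _); [right|left].
rewrite map_inj_in_uniq ?pipe_dreams_uniq // => D D'; rewrite !mp => p p' /eqP.
by rewrite pd_monom_inj // => /eqP; apply: h.
Qed.

(** The letter of s in the role k is entry k - 1 of the increasing list in [order_iso]. *)
Lemma order_iso_homo (sg s : seq nat) a b : sg \in zero_one_patterns -> order_iso sg s ->
  a < size sg -> b < size sg -> nth 0 sg a < nth 0 sg b -> nth 0 s a < nth 0 s b.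
Proof.
move=> hs /andP[_ hc] ha hb hab.
have pq := patterns_perm hs.
have u : uniq sg by rewrite (perm_uniq pq) iota_uniq.
have rg k : k < size sg -> 0 < nth 0 sg k <= size sg.
  by move=> hk; have := mem_nth 0 hk; rewrite (perm_mem pq) mem_iota add1n ltnS.
have E k : k < size sg ->
    nth 0 s k = nth 0 [seq nth 0 s (index k sg) | k <- iota 1 (size sg)] (nth 0 sg k).-1.
  move=> hk; have r := rg k hk; rewrite (nth_map 0) ?size_iota ?nth_iota; try lia.
  by rewrite add1n prednK ?index_uniq //; lia.
rewrite (E a ha) (E b hb); have ra := rg a ha; have rb := rg b hb.
have := sorted_ltn_nth ltn_trans 0 hc (nth 0 sg a).-1 (nth 0 sg b).-1.
by rewrite !inE size_map size_iota; apply; lia.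
Qed.

Lemma containsP w (sg : seq nat) : sg \in zero_one_patterns ->
  contains w sg <-> exists s, occurs (one_line w) s /\ order_iso sg s.
Proof.
move=> hs; have pq := patterns_perm hs.
have u : uniq sg by rewrite (perm_uniq pq) iota_uniq.
split=> [[f [f1 f2]]|[s [/andP[ho1 ho2] hc]]].
  pose s := [seq val (w (f a)) | a <- enum 'I_(size sg)].
  have ss : size s = size sg by rewrite size_map size_enum_ord.
  have ns (a : 'I_(size sg)) : nth 0 s a = w (f a).
    by rewrite (nth_map a) ?size_enum_ord // nth_ord_enum.
  exists s; split.
    apply/andP; split.
      by apply/allP => _ /mapP[a _ ->] /=;
        rewrite std_word_mem ?std_word_one_line ?size_one_line ?ltn_ord.
    apply/(sortedP 0) => k; rewrite size_map ss => hk; have hk' := ltnW hk.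
    rewrite !(nth_map 0) ?ss // -[k]/(val (Ordinal hk')) -[k.+1]/(val (Ordinal hk)) !ns
      !index_one_line.
    exact: f1.
  rewrite /order_iso ss eqxx /=; apply: (homo_sorted_in (P := mem sg) (e := ltn)).
  - move=> k l hk hl hkl; have hk' := hk; have hl' := hl.
    rewrite -!index_mem in hk' hl'.
    rewrite -[index k sg]/(val (Ordinal hk')) -[index l sg]/(val (Ordinal hl')) !ns.
    by have := f2 (Ordinal hk') (Ordinal hl'); rewrite /= !nth_index // => ->.
  - by apply/allP => k; rewrite /= -(perm_mem pq).
  exact: iota_ltn_sorted.
have ss : size s = size sg by move: hc => /andP[/eqP].
have hm (a : 'I_(size sg)) : nth 0 s a \in one_line w.
  by apply: (allP ho1); rewrite mem_nth // ss.
have hi (a : 'I_(size sg)) : index (nth 0 s a) (one_line w) < n.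
  by rewrite -[X in _ < X](size_one_line w) index_mem.
pose f a := Ordinal (hi a).
have wf_ a : w (f a) = nth 0 s a :> nat by rewrite -nth_one_line nth_index.
exists f; split=> a b.
  move=> hab /=; have := sorted_ltn_nth ltn_trans 0 ho2 a b.
  by rewrite !inE size_map ss !ltn_ord => /(_ erefl erefl hab); rewrite !(nth_map 0) ?ss.
rewrite !wf_; case: (ltngtP (nth 0 sg a) (nth 0 sg b)) => h.
- exact: (order_iso_homo hs hc).
- by apply/negbTE; rewrite -leqNgt ltnW //; apply: (order_iso_homo hs hc).
by move/eqP: h; rewrite nth_uniq // => /eqP ->; rewrite ltnn.
Qed.
End Final.

Theorem theorem1p1 (n : nat) (hn : (1 <= n)%N) (w : 'S_n) :
  zero_one (schubert w) <->
  (forall sigma, sigma \in zero_one_patterns -> avoids w sigma).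
Proof.
rewrite zero_oneP; have [h1 h2] := weight_inj_bad (std_word_one_line w).
split=> [hz sg hs /(containsP _ hs)[s [ho hc]]|h].
  by case: (h1 _ hz); exists sg, s.
apply: h2 => -[sg [s [hs ho hc]]]; apply: (h sg hs).
by apply/(containsP _ hs); exists s.
Qed.
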